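(* Let $p$ be an odd prime and let $n$ be a positive integer with $\nu_2(n)\ge 2$ (i.e. $4\mid n$). Let $N_{p^n}$ be the number of pairwise non-isotopic commutative semifields of order $p^n$. Then $$N_{p^n}\ \ge\ \frac{(\sigma(n)-1)\,(p^{n/4}-1)}{2n}.$$
   Context: A (finite) semifield is a finite set $S$ with two operations $+,\circ$ such that $(S,+)$ is a group, $\circ$ is left and right distributive over $+$, $x\circ y=0$ implies $x=0$ or $y=0$, and there is a two-sided identity for $\circ$. It is commutative if $\circ$ is commutative. The additive group of a semifield of order $p^n$ is elementary abelian and is identified with $\mathbb{F}_p^n$. Two (pre-)semifields $(\mathbb{F}_p^n,+,\circ_1)$ and $(\mathbb{F}_p^n,+,\circ_2)$ are isotopic if there are $\mathbb{F}_p$-linear bijections $N,L,M$ of $\mathbb{F}_p^n$ with $N(x\circ_1 y)=L(x)\circ_2 M(y)$ for all $x,y$; this is an equivalence relation, and $N_{p^n}$ is the number of isotopy classes of commutative semifields of order $p^n$. For a positive integer $n$, $\nu_2(n)$ is the $2$-adic valuation of $n$ and $\sigma(n)=n/2^{\nu_2(n)}$ is the odd part of $n$. *)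

(* Defs.v *)
From HB Require Import structures.
From mathcomp Require Import all_boot all_order all_algebra.
From mathcomp Require Import boolp.

Set Implicit Arguments.
Unset Strict Implicit.
Unset Printing Implicit Defensive.

Import GRing.Theory.
Local Open Scope ring_scope.

Section Semifield.
Variables (V : zmodType) (op : V -> V -> V).

Definition is_semifield : Prop :=
  [/\ left_distributive op +%R,
      right_distributive op +%R,
      forall x y, op x y = 0 -> x = 0 \/ y = 0
    & exists e, left_id e op /\ right_id e op].

Definition is_comm_semifield : Prop := is_semifield /\ commutative op.

End Semifield.

Definition isotopic (F : fieldType) (V : lmodType F) (op1 op2 : V -> V -> V) :
    Prop :=
  exists N L M : {linear V -> V},
    [/\ bijective N, bijective L, bijective M
      & forall x y, N (op1 x y) = op2 (L x) (M y)].

(* Binary operations on F_p^n, as finite functions so that they can be        *)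
(* counted.                                                                   *)
Definition binop (p n : nat) : finType :=
  {ffun 'rV['F_p]_n -> {ffun 'rV['F_p]_n -> 'rV['F_p]_n}}.

Definition comm_semifields (p n : nat) : {set binop p n} :=
  [set mu : binop p n | `[< is_comm_semifield (fun x y => mu x y) >]].

Definition isotopicb (p n : nat) : rel (binop p n) := fun mu1 mu2 =>
  `[< isotopic (fun x y => mu1 x y) (fun x y => mu2 x y) >].

Lemma isotopicb_equiv (p n : nat) : equivalence_rel (@isotopicb p n).
Proof.
have inv (f : {linear 'rV['F_p]_n -> 'rV['F_p]_n}) : bijective f ->
    exists2 g : {linear 'rV['F_p]_n -> 'rV['F_p]_n}, cancel f g & cancel g f.
  case=> g fK gK; pose lg := GRing.isLinear.Build _ _ _ _ g (can2_linear fK gK).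
  by exists (HB.pack_for {linear 'rV['F_p]_n -> 'rV['F_p]_n} g lg).
have refl : reflexive (@isotopicb p n).
  move=> mu; apply/asboolP.
  by exists idfun, idfun, idfun; split=> //; apply: inv_bij.
have symm : symmetric (@isotopicb p n).
  apply: symmetric_from_pre => mu1 mu2 /asboolP[N [L [M [bN bL bM E]]]].
  apply/asboolP; have [N' NK N'K] := inv _ bN.
  have [L' LK L'K] := inv _ bL; have [M' MK M'K] := inv _ bM.
  exists N', L', M'; split; [by exists N | by exists L | by exists M |].
  by move=> x y; rewrite -{1}(L'K x) -{1}(M'K y) -E NK.
have trans : transitive (@isotopicb p n).
  move=> mu2 mu1 mu3 /asboolP[N [L [M [bN bL bM E]]]].
  move=> /asboolP[N' [L' [M' [bN' bL' bM' E']]]]; apply/asboolP.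
  exists (N' \o N), (L' \o L), (M' \o M).
  by split; [apply: bij_comp.. | move=> x y /=; rewrite E E'].
by apply/equivalence_relP; split=> //; apply: left_trans.
Qed.

(* The number of isotopy classes of commutative semifields of order p ^ n.    *)
Definition num_comm_semifields (p n : nat) : nat :=
  #|equivalence_partition (@isotopicb p n) (comm_semifields p n)|.

Definition odd_part (n : nat) : nat := (n %/ 2 ^ logn 2 n)%N.

(* Main.v *)
From HB Require Import structures.
Require Import Defs.
From mathcomp Require Import all_boot all_order all_algebra all_fingroup all_field.
From mathcomp Require Import boolp.
From mathcomp Require Import ring lra zify.

Set Implicit Arguments.
Unset Strict Implicit.
Unset Printing Implicit Defensive.

Import Order.TTheory GRing.Theory Num.Theory.
Local Open Scope ring_scope.

(** Write n = 2m with m even, K for the field with p ^ m elements, and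
frob i x = x ^ (p ^ i) for i in Z/m; put c = m / 2, so that the fixed field L
of frob c has p ^ (n / 4) elements.  Fix a B in K that is not a square.  For k
of odd order in Z/m, k <> 0, and for a in L, a <> 0, the form

  (x, y) |-> (x^k x + B y^k y, x^(k+c) y + (a / B) x y^(k+c)),

where x^i stands for frob i x, polarizes to a commutative product gk_mul on
K x K.  It has no zero divisors (gk_mul_eq0), because a zero product would make
a nonsquare times an element of L equal to a value of z^k z, which is a square;
elements of L are squares in K.  Kaplansky's trick (kaplansky) turns the
product into a commutative semifield in the same isotopy class.

The heart of the proof is that isotopisms are monomial (isotopism_monomial).
After extending scalars from F_p to K, the space K x K acquires a basis
permuted by Galois, with coordinates x^i and y^i for i in Z/m, and the product
becomes sparse: in these coordinates its components only link an index j with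
j + k or with j + k + c.  Multiplication by a basis vector has rank four.
Conversely, a vector whose multiplication has rank at most four has at most one
nonzero x-coordinate and at most one nonzero y-coordinate (rank4_mono): two
distinct indices in the support that do not differ by c produce a fifth
independent row, and so does a
pair i, i + c carrying two nonzero x-coordinates or two nonzero y-coordinates,
because a^k a cannot be the norm (B B^c)^k when B is not a square.  An
isotopism preserves these ranks.  Applied to basis vectors and to sums of two of
them, this shows that it sends each basis vector to a multiple of a basis
vector; as it is defined over F_p, its left and right parts have the form
(x, y) |-> (al x^s, de y^t), or the same with the two coordinates swapped.

Comparing coefficients then leaves little freedom.  The index k is determined
up to sign, and theta = a^k a / (B B^c)^k is determined up to a power of
Frobenius and inversion (isotopism_theta).  Restrict k to (t - 1) / 2 values
no two of which are equal or opposite, t being the odd part of n.  As theta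
lies in L and determines a up to sign (theta_inj2), each isotopy class contains
at most 2 * 2 * (m / 2) = n of the (t - 1) / 2 * (p ^ (n / 4) - 1) pairs (k, a);
this is count_semifields. *)

(** * Coefficients of additive maps on a finite field *)

Lemma finField_basis (p d : nat) (K : finFieldType) : p \in [pchar K] ->
    #|K| = (p ^ d)%N ->
  exists b : 'I_d -> K, forall x, exists c : 'I_d -> nat,
    x = \sum_i b i *+ c i.
Proof.
move=> pK cardK; pose V : vectType 'F_p := pPrimeCharType pK.
have p_pr := pcharf_prime pK.
have dimV : \dim (fullv : {vspace V}) = d.
  by rewrite pprimeChar_dimf [#|_|]cardK pfactorK.
exists (fun i => (vbasis (fullv : {vspace V}))`_i) => x.
exists (fun i => nat_of_ord (coord (vbasis (fullv : {vspace V})) (cast_ord (esym dimV) i) x)).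
rewrite {1}(coord_vbasis (memvf (x : V))) (reindex (cast_ord (esym dimV))) /=; last first.
  by exists (cast_ord dimV) => i _; apply/val_inj.
by apply: eq_bigr => i _; rewrite -mulr_natl.
Qed.

Lemma natr_card (K : finFieldType) : #|K|%:R = 0 :> K.
Proof.
have [p p_pr pK] := finPcharP K.
rewrite [#|_|](card_pprimeChar pK) natrX (pcharf0 pK) expr0n /=.
case: logn (card_pprimeChar pK) => // cK1.
by have := finNzRing_gt1 K; rewrite [#|_|]cK1.
Qed.

Section Galois.
Variables (K : finFieldType) (G : finZmodType) (frob : G -> {rmorphism K -> K}).
Hypothesis frobD : forall i j x, frob (i + j) x = frob i (frob j x).
Hypothesis frob_faithful : forall i j, i != j -> exists x, frob i x != frob j x.

Lemma frob0 x : frob 0 x = x.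
Proof. by apply: (fmorph_inj (frob 0)); rewrite -frobD addr0. Qed.

Lemma frob_eq0 i x : (frob i x == 0) = (x == 0).
Proof. exact: fmorph_eq0. Qed.

(** If f is the sum of the a j * frob j, the sum below is - a i: distinct
automorphisms are orthogonal characters of the multiplicative group.  Having
the coefficient as an explicit sum over K makes it K-linear in f for free. *)
Definition coef (i : G) (f : K -> K) : K :=
  - \sum_(x | x != 0) (frob i x)^-1 * f x.

Lemma eq_coef i f g : f =1 g -> coef i f = coef i g.
Proof. by move=> fg; congr (- _); apply: eq_bigr => x _; rewrite fg. Qed.

Lemma frob_coefD i f g : coef i (fun x => f x + g x) = coef i f + coef i g.
Proof.
rewrite /coef -opprD -big_split; congr (- _).
by apply: eq_bigr => x _; rewrite mulrDr.
Qed.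

Lemma frob_coefZ i a f : coef i (fun x => a * f x) = a * coef i f.
Proof.
rewrite /coef mulrN big_distrr; congr (- _).
by apply: eq_bigr => x _; rewrite /= mulrCA.
Qed.

Lemma frob_coef_sum i (I : finType) (f : I -> K -> K) :
  coef i (fun x => \sum_j f j x) = \sum_j coef i (f j).
Proof.
rewrite /coef sumrN exchange_big; congr (- _).
by apply: eq_bigr => x _; rewrite mulr_sumr.
Qed.

(** For i <> j the summand is a nontrivial multiplicative character, whose sum
over the nonzero elements vanishes because translation by a suitable g
multiplies it by a factor different from 1. *)
Lemma coef_frob i j : coef i (frob j) = (i == j)%:R.
Proof.
have [<-|ne] := eqVneq i j.
  rewrite /coef (eq_bigr (fun _ => 1)) => [|x x0]; last first.
    by rewrite mulVf // frob_eq0.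
  rewrite sumr_const cardC1 -subn1 mulrnBr ?(ltnW (finNzRing_gt1 K)) //.
  by rewrite natr_card sub0r opprK.
have [g gne] := frob_faithful ne.
have g0 : g != 0 by apply: contraNneq gne => ->; rewrite !rmorph0.
pose S := \sum_(x | x != 0) (frob i x)^-1 * frob j x.
have ES : S = (frob i g)^-1 * frob j g * S.
  rewrite {1}/S (reindex_onto (fun x => g * x) (fun x => g^-1 * x)) /=; last first.
    by move=> x _; rewrite mulVKf.
  rewrite mulr_sumr; apply: eq_big => [x|x _].
    by rewrite mulKf // eqxx andbT mulf_eq0 (negPf g0).
  by rewrite !rmorphM invfM; ring.
rewrite /coef -/S; suff -> : S = 0 by rewrite oppr0.
apply/eqP; apply: contraNT gne => S0.
have /eqP := ES; rewrite -{1}[S]mul1r => /eqP /(mulIf S0) /esym e.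
by rewrite -[frob i g]mulr1 -e mulrA mulfV ?mul1r // frob_eq0.
Qed.

Lemma coefZ_frob i a j : coef i (fun x => a * frob j x) = a *+ (i == j).
Proof. by rewrite frob_coefZ coef_frob mulr_natr. Qed.

Lemma coef_zero i f : f =1 (fun=> 0) -> coef i f = 0.
Proof. by move=> f0; rewrite /coef big1 ?oppr0 // => x _; rewrite f0 mulr0. Qed.

Lemma coef_sum_frob i (a : G -> K) : coef i (fun x => \sum_j a j * frob j x) = a i.
Proof.
rewrite frob_coef_sum (eq_bigr _ (fun j _ => coefZ_frob _ _ _)).
by rewrite (bigD1 i) //= eqxx mulr1n big1 ?addr0 // => j; rewrite eq_sym => /negPf->.
Qed.

Lemma coef_comp i j f : coef i (fun x => frob j (f x)) = frob j (coef (i - j) f).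
Proof.
rewrite /coef rmorphN rmorph_sum; congr (- _); apply: eq_bigr => x _.
by rewrite rmorphM fmorphV -frobD addrC subrK.
Qed.

Variable p : nat.
Hypothesis pK : p \in [pchar K].
Hypothesis cardK : #|K| = (p ^ #|G|)%N.

(** The powers of Frobenius are linearly independent over K, so the Moore matrix
of a basis of K over the prime field is invertible; solving the corresponding
linear system gives a combination of the frob i that agrees with f on the
basis. *)
Lemma additive_frobE (f : K -> K) : {morph f : x y / x + y} ->
  forall x, f x = \sum_i coef i f * frob i x.
Proof.
move=> fD; have [b spanb] := finField_basis pK cardK.
have fsum (g : K -> K) c : {morph g : x y / x + y} ->
    g (\sum_i b i *+ c i) = \sum_(i < #|G|) g (b i) *+ c i.
  move=> gD; have g0 : g 0 = 0 by apply: (addIr (g 0)); rewrite -gD !add0r.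
  have gMn x n : g (x *+ n) = g x *+ n.
    by elim: n => [|n IH]; rewrite ?mulr0n // !mulrS gD IH.
  by rewrite (big_morph g gD g0); apply: eq_bigr => i _.
(* the Moore matrix *)
pose C := \matrix_(i < #|G|, j < #|G|) frob (enum_val i) (b j).
pose g (v : 'rV[K]_#|G|) x := \sum_i v 0 (enum_rank i) * frob i x.
have gD v : {morph g v : x y / x + y}.
  move=> x y; rewrite -big_split; apply: eq_bigr => i _.
  by rewrite rmorphD mulrDr.
have gC v j : g v (b j) = (v *m C) 0 j.
  rewrite mxE /g (reindex (@enum_val _ G)) /=; last first.
    by apply: onW_bij; apply: enum_val_bij.
  by apply: eq_bigr => l _; rewrite enum_valK mxE.
have Cu : C \in unitmx.
  rewrite -row_free_unit -kermx_eq0; apply/rowV0P => v /sub_kermxP vC.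
  apply/rowP => i; rewrite mxE.
  have := coef_sum_frob (enum_val i) (fun j => v 0 (enum_rank j)).
  rewrite enum_valK => <-; apply: coef_zero => x; rewrite -[LHS]/(g v x).
  have [c ->] := spanb x; rewrite fsum //.
  by apply: big1 => j _; rewrite gC vC mxE mul0rn.
pose a := (\row_j f (b j)) *m invmx C.
have fE x : f x = g a x.
  have [c ->] := spanb x; rewrite !fsum //.
  by apply: eq_bigr => j _; rewrite gC mulmxKV // mxE.
move=> x; rewrite {1}fE; apply: eq_bigr => i _; congr (_ * _).
by rewrite (eq_coef _ fE) (coef_sum_frob i (fun j => a 0 (enum_rank j))).
Qed.

End Galois.

(** * Neighbours in the index group *)

(** The indices j, j + k, j - k, j + k + c, j - k + c are the ones linked to j by
the product. *)

Section Neighbours.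
Variables (G : finComNzRingType) (k c : G) (l : nat).
Hypotheses (c2 : c + c = 0) (c0 : c != 0).
Hypotheses (l_odd : odd l) (kl : k *+ l = 0) (k0 : k != 0).

Lemma oddM_eq0 (x : G) : x *+ l = 0 -> x + x = 0 -> x = 0.
Proof.
move=> xl xx; rewrite -[x]mulr1n -xl -(odd_double_half l) l_odd.
by rewrite mulrnDr -mul2n mulrnA mulr2n xx mul0rn addr0.
Qed.

Lemma mulkl (x : nat) : k *+ x *+ l = 0.
Proof. by rewrite mulrnAC kl mul0rn. Qed.

Lemma kk_neq0 : k + k != 0.
Proof. by apply: contraNneq k0 => /(oddM_eq0 kl)->. Qed.

Lemma k4_neq0 : k *+ 4 != 0.
Proof.
apply: contra kk_neq0 => /eqP k4; apply/eqP/oddM_eq0.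
  by rewrite -mulr2n mulkl.
by rewrite -k4 !mulrS; ring.
Qed.

Lemma kn_neqc n : k *+ n != c.
Proof.
apply: contraNneq c0 => knc; apply/eqP/oddM_eq0 => //.
by rewrite -knc mulkl.
Qed.

Lemma subc (x : G) : x - c = x + c.
Proof. by rewrite -[RHS]addr0 -[X in _ = _ + X]oppr0 -c2; ring. Qed.

(** The differences of indices that occur are multiples of k plus opt_c t. *)
Definition opt_c (t : bool) : G := if t then c else 0.

Lemma kn_opt_c_neq0 n t : (k *+ n == 0) = false -> k *+ n + opt_c t <> 0.
Proof.
case: t => /= [_ e|/eqP kn0]; last by rewrite addr0.
have /negP := kn_neqc n; apply; apply/eqP.
by apply/eqP; rewrite -subr_eq0 subc e.
Qed.

Definition shift (d : bool * bool) : G := (if d.1 then k else - k) + opt_c d.2.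

Lemma eqr_comb (u v x y a b : G) : a = b ->
  x - y + u * (a - b) + v * (c + c) = 0 -> x = y.
Proof. by move=> ->; rewrite subrr c2 !mulr0 !addr0 => /subr0_eq. Qed.

(* derives an equality of indices from e, modulo c + c = 0; the two coefficients
   are the multiples of e and of c + c to be added *)
Ltac gring e :=
  first [ apply: (eqr_comb (u := 1) (v := 0) e); ring
        | apply: (eqr_comb (u := -1) (v := 0) e); ring
        | apply: (eqr_comb (u := 1) (v := 1) e); ring
        | apply: (eqr_comb (u := -1) (v := 1) e); ring
        | apply: (eqr_comb (u := 1) (v := -1) e); ring
        | apply: (eqr_comb (u := -1) (v := -1) e); ring ].

Lemma k_eq0F : (k *+ 1 == 0) = false. Proof. exact: negbTE k0. Qed.
Lemma k2_eq0F : (k *+ 2 == 0) = false. Proof. exact: negbTE kk_neq0. Qed.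
Lemma k4_eq0F : (k *+ 4 == 0) = false. Proof. exact: negbTE k4_neq0. Qed.

Lemma shift_neq0 d : shift d <> 0.
Proof.
case: d => [[] t] /= e; apply: (@kn_opt_c_neq0 1 t k_eq0F); rewrite mulr1n; move: e;
  by rewrite /shift /=; case: t => /= e; gring e.
Qed.

Lemma shift_neqc d : shift d <> c.
Proof.
case: d => [[] t] /= e; apply: (@kn_opt_c_neq0 1 (~~ t) k_eq0F); rewrite mulr1n; move: e;
  by rewrite /shift /=; case: t => /= e; gring e.
Qed.

Lemma shift_inj : injective shift.
Proof.
move=> [s t] [s' t'] e.
have ss' : s = s'.
  apply/eqP/negPn/negP => ss'; apply: (@kn_opt_c_neq0 2 (t (+) t') k2_eq0F).
  move: ss' e; rewrite mulr2n /shift /=.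
  by case: s s' t t' => [] [] //= [] [] //= _ e; gring e.
suff: t = t' by rewrite ss' => ->.
apply/eqP/negPn/negP => tt'; apply/negP: c0; rewrite negbK; apply/eqP.
by move: tt' e; rewrite -ss' /shift /=; case: s {ss'} t t' => [] [] [] //= _ e; gring e.
Qed.

(** Two indices whose difference d is neither 0 nor c do not have the same
neighbours: the first has a neighbour that is neither the second index nor one
of its neighbours.  If d + k or d + k + c were bad for every choice of sign,
then d would be congruent to both 2 k and - 2 k modulo c, against the odd order
of k. *)
Lemma shift_escape d : d <> 0 -> d <> c ->
  exists s, d + shift s <> 0 /\ forall s', d + shift s <> shift s'.
Proof.
move=> d0 dc.
have [s Hs] : exists s, forall t s', d + shift (s, t) <> shift s'.
  case: (pselect (exists t, d = k + k + opt_c t)) => [[t0 dE]|nd].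
    exists true => t [[] t'] e.
      apply: (@kn_opt_c_neq0 2 (t0 (+) t (+) t') k2_eq0F); move: e; rewrite dE mulr2n /shift /=.
      by case: t0 t t' {dE} => [] [] [] /= e; gring e.
    apply: (@kn_opt_c_neq0 4 (t0 (+) t (+) t') k4_eq0F); move: e; rewrite dE !mulrS mulr0n /shift /=.
    by case: t0 t t' {dE} => [] [] [] /= e; gring e.
  exists false => t [[] t'] e.
    by apply: nd; exists (t (+) t'); move: e; rewrite /shift /=; case: t t' => [] [] /= e; gring e.
  have : d = opt_c (t (+) t') by move: e; rewrite /shift /=; case: t t' => [] [] /= e; gring e.
  by case: (t (+) t').
case: (eqVneq (d + shift (s, false)) 0) => [e|/eqP ne]; last by exists (s, false).
exists (s, true); split=> // e'; apply/negP: c0; rewrite negbK; apply/eqP.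
by move: e e'; rewrite /shift /= addr0 => e; rewrite addrA e add0r.
Qed.

End Neighbours.

(** * The rank four condition *)

Definition inspan (K : fieldType) (T : Type) r (g : 'I_r -> T -> K) (f : T -> K) :=
  exists a : 'I_r -> K, forall y, f y = \sum_j a j * g j y.

Lemma inspan_sum (K : fieldType) (T : Type) r (g : 'I_r -> T -> K) (I : finType)
    (b : I -> K) (f : I -> T -> K) :
  (forall i, inspan g (f i)) -> inspan g (fun y => \sum_i b i * f i y).
Proof.
move=> /choice[a fE]; exists (fun j => \sum_i b i * a i j) => y.
under [RHS]eq_bigr do rewrite mulr_suml.
rewrite exchange_big; apply: eq_bigr => i _.
by rewrite fE mulr_sumr; apply: eq_bigr => j _; rewrite mulrA.
Qed.

Lemma inspanD (K : fieldType) (T : Type) r (g : 'I_r -> T -> K) (f f' : T -> K) :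
  inspan g f -> inspan g f' -> inspan g (fun y => f y + f' y).
Proof.
move=> [a fE] [a' fE']; exists (fun j => a j + a' j) => y.
by rewrite fE fE' -big_split; apply: eq_bigr => j _; rewrite mulrDl.
Qed.

Lemma inspan_dep (K : fieldType) (T : Type) r (g : 'I_r -> T -> K) (I : finType)
    (f : I -> T -> K) : (r < #|I|)%N -> (forall i, inspan g (f i)) ->
  exists2 b : I -> K, exists i, b i != 0 & forall y, \sum_i b i * f i y = 0.
Proof.
move=> rI /choice[a fE].
pose A := \matrix_(i < #|I|, j < r) a (enum_val i) j.
have : kermx A != 0.
  rewrite kermx_eq0 /row_free; apply: contraTneq rI => <-.
  by rewrite -leqNgt rank_leq_col.
case/rowV0Pn => v /sub_kermxP vA v0.
exists (fun i => v 0 (enum_rank i)).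
  have [i vi] : exists i, v 0 i != 0.
    apply/existsP; apply: contraNT v0 => /existsPn v0; apply/eqP/rowP => i.
    by rewrite mxE; apply/eqP/negPn/v0.
  by exists (enum_val i); rewrite enum_valK.
move=> y; under eq_bigr do rewrite fE mulr_sumr.
rewrite exchange_big big1 // => j _.
under eq_bigr do rewrite mulrA.
rewrite -mulr_suml [X in X * _](_ : _ = 0) ?mul0r //.
transitivity ((v *m A) 0 j); [rewrite mxE | by rewrite vA mxE].
rewrite (reindex (@enum_val _ I)) /=; last by apply: onW_bij; apply: enum_val_bij.
by apply: eq_bigr => i _; rewrite enum_valK mxE.
Qed.

Section Rank.
Variables (K : finFieldType) (G : finComNzRingType).
Variable frob : G -> {rmorphism K -> K}.
Hypothesis frobD : forall i j x, frob (i + j) x = frob i (frob j x).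
Hypothesis frob_faithful : forall i j, i != j -> exists x, frob i x != frob j x.
Variables (k c : G) (l : nat).
Hypotheses (c2 : c + c = 0) (c0 : c != 0).
Hypotheses (l_odd : odd l) (kl : k *+ l = 0) (k0 : k != 0).
Variables B a : K.
Hypotheses (B0 : B != 0) (a0 : a != 0) (ac : frob c a = a).
Hypothesis Ba : frob k a * a != frob k (B * frob c B).

Section Rows.
Variables (xi eta : G -> K).

(** With xi j and eta j the x- and y-coordinates of a vector after extension of
scalars, rowF and rowG are the coordinates of index j of its product with Y.
They are the rows of the multiplication matrix, which is regarded as a graph on
the indices: rowF j is an edge from j to j + k, rowG j one from j to j + k + c. *)
Definition rowF (j : G) (Y : K * K) : K :=
  xi (j + k) * frob j Y.1 + xi j * frob (j + k) Y.1 +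
  frob j B * (eta (j + k) * frob j Y.2 + eta j * frob (j + k) Y.2).

Definition rowG (j : G) (Y : K * K) : K :=
  xi (j + (k + c)) * frob j Y.2 + frob (j + (k + c)) Y.1 * eta j +
  frob j (a / B) * (xi j * frob (j + (k + c)) Y.2 + frob j Y.1 * eta (j + (k + c))).

(** The edge that leaves i in direction d.  When d.1 is false, i is the far end
of the row and the row is indexed by its near end. *)
Definition edge (i : G) (d : bool * bool) : K * K -> K :=
  (if d.2 then rowG else rowF) (if d.1 then i else i + shift k c d).

(** The block of the row edge i d at the vertex i + shift k c d.  It depends only
on the coordinates xi i and eta i. *)
Definition outer (i : G) (d : bool * bool) : K * K :=
  match d with
  | (true, false) => (xi i, frob i B * eta i)
  | (true, true) => (eta i, frob i (a / B) * xi i)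
  | (false, false) => (xi i, frob (i - k) B * eta i)
  | (false, true) => (frob (i - k + c) (a / B) * eta i, xi i)
  end.

Lemma edgeE i d : exists q : K * K, forall Y, edge i d Y =
  (outer i d).1 * frob (i + shift k c d) Y.1 +
  (outer i d).2 * frob (i + shift k c d) Y.2 +
  (q.1 * frob i Y.1 + q.2 * frob i Y.2).
Proof.
case: d => [[] []]; rewrite /edge /outer /shift /opt_c /= /rowF /rowG ?addr0.
- exists (frob i (a / B) * eta (i + (k + c)), xi (i + (k + c))) => Y /=; ring.
- exists (xi (i + k), frob i B * eta (i + k)) => Y /=; ring.
- have -> : i + (- k + c) + (k + c) = i.
    by rewrite -[RHS]addr0 -c2; ring.
  rewrite addrA; exists (eta (i - k + c), frob (i - k + c) (a / B) * xi (i - k + c)) => Y /=.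
  ring.
- rewrite subrK; exists (xi (i - k), frob (i - k) B * eta (i - k)) => Y /=; ring.
Qed.

Lemma coef_edge1 b v d : b <> v ->
  coef frob b (fun u => edge v d (u, 0)) = (outer v d).1 *+ (b == v + shift k c d).
Proof.
move=> /eqP/negPf bv; have [q edE] := edgeE v d.
rewrite (eq_coef _ _ (g := fun u => (outer v d).1 * frob (v + shift k c d) u +
    q.1 * frob v u)) => [|u]; last by rewrite edE /= !rmorph0; ring.
by rewrite frob_coefD !(coefZ_frob frob_faithful) bv addr0.
Qed.

Lemma coef_edge2 b v d : b <> v ->
  coef frob b (fun u => edge v d (0, u)) = (outer v d).2 *+ (b == v + shift k c d).
Proof.
move=> /eqP/negPf bv; have [q edE] := edgeE v d.
rewrite (eq_coef _ _ (g := fun u => (outer v d).2 * frob (v + shift k c d) u +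
    q.2 * frob v u)) => [|u]; last by rewrite edE /= !rmorph0; ring.
by rewrite frob_coefD !(coefZ_frob frob_faithful) bv addr0.
Qed.

(** If all rows lie in a space of dimension four, then the four edges at i and
any fifth edge satisfy a linear relation.  It is read off at a vertex b other
than the two sources i and i', where only the outer blocks contribute; once the
fifth coefficient z' vanishes, b may be i' as well. *)
Lemma edge_relation (g : 'I_4 -> K * K -> K) i i' d' :
    (forall j, inspan g (rowF j)) -> (forall j, inspan g (rowG j)) ->
  exists (z : bool * bool -> K) (z' : K), ((exists d, z d != 0) \/ z' != 0) /\
  forall b, b <> i -> b <> i' \/ z' = 0 ->
    \sum_d z d * ((outer i d).1 *+ (b == i + shift k c d))
      + z' * ((outer i' d').1 *+ (b == i' + shift k c d')) = 0 /\
    \sum_d z d * ((outer i d).2 *+ (b == i + shift k c d))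
      + z' * ((outer i' d').2 *+ (b == i' + shift k c d')) = 0.
Proof.
move=> spF spG; have spE v d : inspan g (edge v d).
  by rewrite /edge; case: d.2.
pose f (t : bool * bool + unit) := if t is inl d then edge i d else edge i' d'.
have [||z [t zt] rel] := @inspan_dep _ _ _ g _ f.
- by rewrite card_sum card_prod card_bool card_unit.
- by case=> [d|_] /=; apply: spE.
exists (fun d => z (inl d)), (z (inr tt)); split.
  by case: t zt => [d|[]] zt; [left; exists d | right].
move=> b bi bi'.
have coE h : coef frob b (fun u => \sum_t z t * f t (h u)) =
    \sum_d z (inl d) * coef frob b (fun u => edge i d (h u))
    + z (inr tt) * coef frob b (fun u => edge i' d' (h u)).
  rewrite frob_coef_sum big_sumType /= [X in _ + X](big_pred1 tt) => [|[]] //.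
  by rewrite frob_coefZ; congr (_ + _); apply: eq_bigr => d _; rewrite frob_coefZ.
have co0 h : (forall u, \sum_t z t * f t (h u) = 0) ->
    \sum_d z (inl d) * coef frob b (fun u => edge i d (h u))
    + z (inr tt) * coef frob b (fun u => edge i' d' (h u)) = 0.
  by move=> h0; rewrite -coE; apply: coef_zero.
have [e1 e2] := (co0 _ (fun u => rel (u, 0)), co0 _ (fun u => rel (0, u))).
split; [rewrite -[RHS]e1 | rewrite -[RHS]e2]; congr (_ + _);
  try (by apply: eq_bigr => d _; rewrite ?coef_edge1 ?coef_edge2);
  by case: bi' => [bi'|->]; rewrite ?mul0r // ?coef_edge1 ?coef_edge2.
Qed.

Definition supported i := (xi i != 0) || (eta i != 0).

Lemma outer_neq0 i d (z : K) : supported i ->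
  z * (outer i d).1 = 0 -> z * (outer i d).2 = 0 -> z = 0.
Proof.
have frB j : frob j B != 0 by rewrite frob_eq0.
have frA j : frob j (a / B) != 0 by rewrite frob_eq0 mulf_neq0 ?invr_neq0.
move=> nzi e1 e2; apply/eqP; apply: contraTT nzi => z0; rewrite /supported negb_or !negbK.
move: e1 e2 => /eqP; rewrite mulf_eq0 (negPf z0) /= => e1 /eqP.
rewrite mulf_eq0 (negPf z0) /=; move: e1.
by case: d => [[] []]; rewrite /= ?mulf_eq0 ?(negPf (frB _)) ?(negPf (frA _)) /= => -> ->.
Qed.

Let shI := shift_inj c2 c0 l_odd kl k0.
Let sh0 := shift_neq0 c2 c0 l_odd kl k0.
Let shc := shift_neqc c2 c0 l_odd kl k0.

Lemma sum_outer i d (z : bool * bool -> K) (p : K * K -> K) :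
  \sum_d' z d' * (p (outer i d') *+ (i + shift k c d == i + shift k c d')) =
  z d * p (outer i d).
Proof.
rewrite (bigD1 d) //= eqxx big1 ?addr0 // => d' dd'.
rewrite (inj_eq (addrI i)) (inj_eq shI) eq_sym (negPf dd') mulr0n mulr0 //.
Qed.

Lemma add_shift_neq i d : i + shift k c d <> i.
Proof. by rewrite -[RHS]addr0 => /addrI; apply: sh0. Qed.

Lemma add_shift_neqc i d : i + shift k c d <> i + c.
Proof. by move/addrI; apply: shc. Qed.

(** If i' were another vertex of the support, not equal to i + c, it would have
an edge towards a vertex other than i and not linked to i.  At that vertex the relation
forces the fifth coefficient to vanish, and then the other four vanish at the
four neighbours of i. *)
Lemma rank4_near (g : 'I_4 -> K * K -> K) i i' :
    (forall j, inspan g (rowF j)) -> (forall j, inspan g (rowG j)) ->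
  supported i -> supported i' -> i' = i \/ i' = i + c.
Proof.
move=> spF spG nzi nzi'.
have [/subr0_eq-> | /eqP d0] := eqVneq (i' - i) 0; [by left|].
have [/eqP | /eqP dc] := eqVneq (i' - i) c; [by rewrite subr_eq addrC => /eqP; right|].
have [d' [ne ne']] := shift_escape c2 c0 l_odd kl k0 d0 dc.
have i'E : i' + shift k c d' = i + (i' - i + shift k c d') by ring.
have [z [z' [nzz rel]]] := edge_relation i i' d' spF spG.
have z'0 : z' = 0.
  have [||e1 e2] := rel (i' + shift k c d').
  - by rewrite i'E -[RHS]addr0 => /addrI.
  - by left; apply: add_shift_neq.
  have out p : \sum_d z d * (p (outer i d) *+ (i' + shift k c d' == i + shift k c d)) = 0 :> K.
    apply: big1 => d _; rewrite i'E (inj_eq (addrI i)).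
    by case: eqP => [/ne'//|_]; rewrite mulr0.
  move: e1 e2; rewrite (out fst) (out snd) eqxx !add0r; exact: outer_neq0.
case: nzz => [[d]|]; last by rewrite z'0 eqxx.
case/negP; apply/eqP.
have [||e1 e2] := rel (i + shift k c d); [exact: add_shift_neq | by right |].
move: e1 e2; rewrite (sum_outer _ _ _ fst) (sum_outer _ _ _ snd) z'0 !mul0r !addr0.
exact: outer_neq0.
Qed.

(** The vertices i and i + c have the same neighbours.  At a common neighbour
their outer blocks must be proportional: otherwise both coefficients vanish
there, and again all the others do. *)
Lemma rank4_det (g : 'I_4 -> K * K -> K) i d d' :
    (forall j, inspan g (rowF j)) -> (forall j, inspan g (rowG j)) ->
  supported i -> i + shift k c d = i + c + shift k c d' ->
  (outer i d).1 * (outer (i + c) d').2 = (outer i d).2 * (outer (i + c) d').1.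
Proof.
move=> spF spG nzi dd'; apply/eqP; apply: contraT; rewrite -subr_eq0 => det0.
have [z [z' [nzz rel]]] := edge_relation i (i + c) d' spF spG.
have ic e : i + shift k c e <> i + c by apply: add_shift_neqc.
have [||] := rel (i + shift k c d); [exact: add_shift_neq | by left |].
rewrite (sum_outer _ _ _ fst) (sum_outer _ _ _ snd) -dd' eqxx !mulr1n => e1 e2.
have z'0 : z' = 0.
  apply: (mulIf det0); rewrite mul0r.
  transitivity ((outer i d).1 * (z d * (outer i d).2 + z' * (outer (i + c) d').2)
     - (outer i d).2 * (z d * (outer i d).1 + z' * (outer (i + c) d').1)); first by ring.
  by rewrite e1 e2 !mulr0 subr0.
case: nzz => [[e]|]; last by rewrite z'0 eqxx.
case/negP; apply/eqP.
have [||f1 f2] := rel (i + shift k c e); [exact: add_shift_neq | by right |].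
move: f1 f2; rewrite (sum_outer _ _ _ fst) (sum_outer _ _ _ snd) z'0 !mul0r !addr0.
exact: outer_neq0.
Qed.

(** The proportionality at the neighbours i + k and i - k gives two linear
relations between the products xi i * xi (i + c) and eta i * eta (i + c); they
are independent because frob k a * a is not frob k (B * frob c B). *)
Lemma rank4_prod (g : 'I_4 -> K * K -> K) i :
    (forall j, inspan g (rowF j)) -> (forall j, inspan g (rowG j)) ->
  supported i -> xi i * xi (i + c) = 0 /\ eta i * eta (i + c) = 0.
Proof.
move=> spF spG nzi.
have e1 := @rank4_det g i (true, false) (true, true) spF spG nzi.
have e2 := @rank4_det g i (false, false) (false, true) spF spG nzi.
move: e1 e2; rewrite /outer /shift /opt_c /= !addr0.
have -> : i + c + (k + c) = i + k by rewrite -[RHS]addr0 -c2; ring.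
have -> : i + c + (- k + c) = i - k by rewrite -[RHS]addr0 -c2; ring.
have -> : i + c - k + c = i - k by rewrite -[RHS]addr0 -c2; ring.
move=> /(_ erefl) e1 /(_ erefl) e2.
have {}e2 : xi i * xi (i + c) = frob (i - k) a * (eta i * eta (i + c)).
  have -> : a = B * (a / B) by rewrite mulrCA mulfV ?mulr1.
  by rewrite e2 rmorphM; ring.
have eta0 : eta i * eta (i + c) = 0.
  apply/eqP; apply: contraNT Ba => eta0; apply/eqP.
  have e3 : frob (i - k) a * frob (i + c) (a / B) = frob i B.
    apply: (mulIf eta0); transitivity (frob (i + c) (a / B) * (xi i * xi (i + c))).
      by rewrite e2; ring.
    by rewrite -[LHS]mulrCA e1; ring.
  have e4 : frob (i - k) a * frob i a = frob i B * frob (i + c) B.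
    rewrite -e3 -[X in frob i X]ac -frobD -mulrA -rmorphM mulfVK //.
  have := congr1 (frob (k - i)) e4.
  rewrite !rmorphM -!frobD.
  have -> : k - i + (i - k) = 0 by ring.
  have -> : k - i + i = k by ring.
  have -> : k - i + (i + c) = k + c by ring.
  by rewrite (frob0 frobD) [frob (k + c) _]frobD => <-; ring.
by split=> //; rewrite e2 eta0 mulr0.
Qed.

Lemma rank4_mono (g : 'I_4 -> K * K -> K) i i' :
    (forall j, inspan g (rowF j)) -> (forall j, inspan g (rowG j)) ->
  (xi i != 0 -> xi i' != 0 -> i = i') /\ (eta i != 0 -> eta i' != 0 -> i = i').
Proof.
move=> spF spG; split=> x0 x0'.
  have nzi : supported i by rewrite /supported x0.
  have nzi' : supported i' by rewrite /supported x0'.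
  have [//|e] := rank4_near spF spG nzi nzi'.
  have [/eqP] := rank4_prod spF spG nzi.
  by rewrite -e mulf_eq0 (negPf x0) (negPf x0').
have nzi : supported i by rewrite /supported x0 orbT.
have nzi' : supported i' by rewrite /supported x0' orbT.
have [//|e] := rank4_near spF spG nzi nzi'.
have [_ /eqP] := rank4_prod spF spG nzi.
by rewrite -e mulf_eq0 (negPf x0) (negPf x0').
Qed.

End Rows.
End Rank.

(** * The product and its extension of scalars *)

Section Product.
Variables (K : finFieldType) (G : finComNzRingType).
Variable frob : G -> {rmorphism K -> K}.

(** The polarization of
(x, y) |-> (frob k x * x + B * (frob k y * y),
            frob (k + c) x * y + a / B * (x * frob (k + c) y)). *)
Definition gk_mul (c k : G) (B a : K) (X Y : K * K) : K * K :=
  (frob k X.1 * Y.1 + X.1 * frob k Y.1 +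
     B * (frob k X.2 * Y.2 + X.2 * frob k Y.2),
   frob (k + c) X.1 * Y.2 + frob (k + c) Y.1 * X.2 +
     a / B * (X.1 * frob (k + c) Y.2 + Y.1 * frob (k + c) X.2)).

Lemma gk_mulC c k B a : commutative (gk_mul c k B a).
Proof. by move=> X Y; congr (_, _); rewrite /=; ring. Qed.

Lemma gk_mulDl c k B a : left_distributive (gk_mul c k B a) +%R.
Proof. by move=> X Y Z; congr (_, _); rewrite /= !rmorphD; ring. Qed.

Hypothesis frobD : forall i j x, frob (i + j) x = frob i (frob j x).
Hypothesis frob_faithful : forall i j, i != j -> exists x, frob i x != frob j x.
Variable c : G.
Hypotheses (c2 : c + c = 0) (c0 : c != 0).

(** Evaluation of additive maps, extended to K-valued ones, at the vector
e1 * X_0 + e2 * Y_e of the extension of scalars, where X_i and Y_i are the basis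
vectors dual to the coordinates frob i x and frob i y. *)
Definition probe (e1 e2 : K) (e : G) (f : K * K -> K) : K :=
  e1 * coef frob 0 (fun x => f (x, 0)) + e2 * coef frob e (fun y => f (0, y)).

Lemma eq_probe e1 e2 e f g : f =1 g -> probe e1 e2 e f = probe e1 e2 e g.
Proof. by move=> fg; congr (_ * _ + _ * _); apply: eq_coef => x. Qed.

Lemma probeD e1 e2 e f g :
  probe e1 e2 e (fun X => f X + g X) = probe e1 e2 e f + probe e1 e2 e g.
Proof. by rewrite /probe !frob_coefD; ring. Qed.

Lemma probeZ e1 e2 e b f : probe e1 e2 e (fun X => b * f X) = b * probe e1 e2 e f.
Proof. by rewrite /probe !frob_coefZ; ring. Qed.

Lemma probe_sum e1 e2 e (I : finType) (f : I -> K * K -> K) :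
  probe e1 e2 e (fun X => \sum_i f i X) = \sum_i probe e1 e2 e (f i).
Proof. by rewrite /probe !frob_coef_sum !mulr_sumr -big_split. Qed.

Section Source.
Variables (k : G) (l : nat) (B a : K).
Hypotheses (l_odd : odd l) (kl : k *+ l = 0) (k0 : k != 0).

Definition four (T : Type) (g0 g1 g2 g3 : T -> K) (j : 'I_4) : T -> K :=
  nth g0 [:: g0; g1; g2; g3] j.

Lemma inspan4 (T : Type) (g0 g1 g2 g3 f : T -> K) b0 b1 b2 b3 :
  (forall y, f y = b0 * g0 y + b1 * g1 y + b2 * g2 y + b3 * g3 y) ->
  inspan (four g0 g1 g2 g3) f.
Proof.
move=> fE; exists (fun j : 'I_4 => nth 0 [:: b0; b1; b2; b3] j) => y.
by rewrite fE !big_ord_recl big_ord0 /four /= addr0 !addrA.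
Qed.

Lemma probe_mul1 e1 e2 e i Y :
  probe e1 e2 e (fun X => frob i (gk_mul c k B a X Y).1) =
  e1 * ((0 == i + k)%:R * frob i Y.1 + (0 == i)%:R * frob (i + k) Y.1) +
  e2 * frob i B * ((e == i + k)%:R * frob i Y.2 + (e == i)%:R * frob (i + k) Y.2).
Proof.
rewrite /probe.
rewrite (eq_coef frob _ (g := fun x =>
  frob i Y.1 * frob (i + k) x + frob (i + k) Y.1 * frob i x)); last first.
  by move=> x /=; rewrite !(rmorphD, rmorphM, rmorph0) /= -!frobD; ring.
rewrite (eq_coef frob e (g := fun x => frob i B * frob i Y.2 * frob (i + k) x +
  frob i B * frob (i + k) Y.2 * frob i x)); last first.
  by move=> x /=; rewrite !(rmorphD, rmorphM, rmorph0) /= -!frobD; ring.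
by rewrite !frob_coefD !frob_coefZ !(coef_frob frob_faithful); ring.
Qed.

Lemma probe_mul2 e1 e2 e i Y (h := k + c) :
  probe e1 e2 e (fun X => frob i (gk_mul c k B a X Y).2) =
  e1 * ((0 == i + h)%:R * frob i Y.2 + (0 == i)%:R * (frob i (a / B) * frob (i + h) Y.2)) +
  e2 * ((e == i)%:R * frob (i + h) Y.1 + (e == i + h)%:R * (frob i (a / B) * frob i Y.1)).
Proof.
rewrite /probe.
rewrite (eq_coef frob _ (g := fun x => frob i Y.2 * frob (i + h) x +
  frob i (a / B) * frob (i + h) Y.2 * frob i x)); last first.
  by move=> x /=; rewrite !(rmorphD, rmorphM, rmorph0) /= -!frobD /h; ring.
rewrite (eq_coef frob e (g := fun x => frob (i + h) Y.1 * frob i x +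
  frob i (a / B) * frob i Y.1 * frob (i + h) x)); last first.
  by move=> x /=; rewrite !(rmorphD, rmorphM, rmorph0) /= -!frobD /h; ring.
by rewrite !frob_coefD !frob_coefZ !(coef_frob frob_faithful); ring.
Qed.

(** Multiplication by e1 * X_0 + e2 * Y_0 or by e1 * X_0 + e2 * Y_c has rank at
most four.  In the first case only four of its rows are nonzero.  In the second
case eight rows are nonzero but they only involve four coordinates of Y, because
the neighbours of 0 and of c are the same. *)
Lemma probe_mul_span e1 e2 e : e = 0 \/ e = c ->
  exists g : 'I_4 -> K * K -> K, forall i,
    inspan g (fun Y => probe e1 e2 e (fun X => frob i (gk_mul c k B a X Y).1)) /\
    inspan g (fun Y => probe e1 e2 e (fun X => frob i (gk_mul c k B a X Y).2)).
Proof.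
have h0 : - k + c <> 0.
  by have := @shift_neq0 _ k c l c2 c0 l_odd kl k0 (false, true).
have ek i j : (i == j + k) = (j == i - k).
  by rewrite -subr_eq eq_sym.
have eh i j : (i == j + (k + c)) = (j == i - k + c).
  by rewrite addrA -[LHS]subr_eq -[LHS]subr_eq eq_sym (subc c2) addrAC.
have at_eq i j (F : G -> K) : (i == j)%:R * F i = (i == j)%:R * F j.
  by case: eqP => [->|_]; rewrite ?mul0r.
case=> ->.
  exists (four (fun Y => probe e1 e2 0 (fun X => frob 0 (gk_mul c k B a X Y).1))
    (fun Y => probe e1 e2 0 (fun X => frob (- k) (gk_mul c k B a X Y).1))
    (fun Y => probe e1 e2 0 (fun X => frob 0 (gk_mul c k B a X Y).2))
    (fun Y => probe e1 e2 0 (fun X => frob (- k + c) (gk_mul c k B a X Y).2))) => i.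
  split.
    apply: (inspan4 (b0 := (i == 0)%:R) (b1 := (i == - k)%:R) (b2 := 0) (b3 := 0)) => Y.
    have [->|i0] := eqVneq i 0; first by rewrite eq_sym oppr_eq0 (negPf k0) /=; ring.
    have [->|ik] := eqVneq i (- k); first by rewrite /=; ring.
    by rewrite probe_mul1 !ek sub0r (negPf ik) [0 == i]eq_sym (negPf i0) /=; ring.
  apply: (inspan4 (b0 := 0) (b1 := 0) (b2 := (i == 0)%:R) (b3 := (i == - k + c)%:R)) => Y.
  have [->|i0] := eqVneq i 0.
    by have [/esym/h0//|_] := eqVneq 0 (- k + c); rewrite /=; ring.
  have [->|ik] := eqVneq i (- k + c); first by rewrite /=; ring.
  by rewrite probe_mul2 !eh sub0r (negPf ik) [0 == i]eq_sym (negPf i0) /=; ring.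
exists (four (fun Y => frob k Y.1) (fun Y => frob (- k) Y.1)
  (fun Y => frob (k + c) Y.2) (fun Y => frob (- k + c) Y.2)) => i; split.
  apply: (inspan4 (b0 := e1 * (i == 0)%:R) (b1 := e1 * (i == - k)%:R)
     (b2 := e2 * frob i B * (i == c)%:R) (b3 := e2 * frob i B * (i == - k + c)%:R)) => Y.
  rewrite probe_mul1 !ek sub0r [c - k]addrC [0 == i]eq_sym [c == i]eq_sym.
  rewrite !(at_eq i _ (fun j => frob j _)) !(at_eq i _ (fun j => frob (j + k) _)).
  by rewrite add0r [c + k]addrC; ring.
apply: (inspan4 (b0 := e2 * (i == c)%:R) (b1 := e2 * frob i (a / B) * (i == - k)%:R)
     (b2 := e1 * frob i (a / B) * (i == 0)%:R) (b3 := e1 * (i == - k + c)%:R)) => Y.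
rewrite probe_mul2 !eh sub0r [0 == i]eq_sym [c == i]eq_sym.
rewrite [c - k + c]addrAC c2 sub0r.
rewrite ![_ * (frob i (a / B) * _)]mulrCA.
rewrite !(at_eq i _ (fun j => frob j Y.1)) !(at_eq i _ (fun j => frob j Y.2)).
rewrite !(at_eq i _ (fun j => frob (j + (k + c)) _)).
rewrite add0r [c + (k + c)]addrCA c2 addr0; ring.
Qed.

End Source.

Definition at_most_one (f : G -> K) := forall i j, f i != 0 -> f j != 0 -> i = j.

Lemma at_most_one_sum f s : at_most_one f -> f s != 0 ->
  forall x, \sum_i f i * frob i x = f s * frob s x.
Proof.
move=> f1 fs x; rewrite (bigD1 s) //= big1 ?addr0 // => i.
by apply: contraNeq => fi; apply/eqP/f1 => //; apply: contraNneq fi => ->; rewrite mul0r.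
Qed.

(** If f and g were both nonzero, at s and t, the third hypothesis would force
s = t and the fourth s = t + c. *)
Lemma at_most_one_shift (f g : G -> K) : at_most_one f -> at_most_one g ->
    at_most_one (fun i => f i + g i) -> at_most_one (fun i => f i + g (c + i)) ->
  f =1 (fun=> 0) \/ g =1 (fun=> 0).
Proof.
move=> f1 g1 fg fgc.
have [/existsP[s fs]|/existsPn f0] := boolP [exists i, f i != 0]; last first.
  by left=> i; apply/eqP/negPn.
have [/existsP[t gt]|/existsPn g0] := boolP [exists i, g i != 0]; last first.
  by right=> i; apply/eqP/negPn.
have fE i : i <> s -> f i = 0.
  by move=> si; apply/eqP/negPn/negP => /(f1 _ _ fs)/esym.
have gE i : i <> t -> g i = 0.
  by move=> ti; apply/eqP/negPn/negP => /(g1 _ _ gt)/esym.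
have st : s = t.
  apply: contrapT => st; apply: (st); apply: fg.
    by rewrite (gE _ st) addr0.
  by rewrite (fE t) ?add0r // => /esym.
have ct i : c + i <> i by rewrite -[RHS]add0r => /addIr/eqP; rewrite (negPf c0).
case: (@ct s); symmetry; apply: fgc.
  by rewrite gE ?addr0 // -st.
by rewrite (fE _ (@ct s)) add0r addrA c2 add0r st.
Qed.

End Product.

(** * Isotopisms are monomial *)

Section Isotopism.
Variables (K : finFieldType) (G : finComNzRingType).
Variable frob : G -> {rmorphism K -> K}.
Hypothesis frobD : forall i j x, frob (i + j) x = frob i (frob j x).
Hypothesis frob_faithful : forall i j, i != j -> exists x, frob i x != frob j x.
Variable p : nat.
Hypotheses (pK : p \in [pchar K]) (cardK : #|K| = (p ^ #|G|)%N).
Variable c : G.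
Hypotheses (c2 : c + c = 0) (c0 : c != 0).

Lemma additive_frob2E (f : K * K -> K) : {morph f : X Y / X + Y} -> forall X,
  f X = \sum_i coef frob i (fun x => f (x, 0)) * frob i X.1 +
        \sum_i coef frob i (fun y => f (0, y)) * frob i X.2.
Proof.
move=> fD [x y] /=; have {1}-> : (x, y) = (x, 0) + (0, y) :> K * K.
  by congr (_, _); rewrite /= ?addr0 ?add0r.
have fE := additive_frobE frob_faithful pK cardK.
rewrite fD; congr (_ + _).
  rewrite -(fE (fun x => f (x, 0))) // => u v.
  by rewrite -fD; congr (f (_, _)); rewrite /= addr0.
rewrite -(fE (fun y => f (0, y))) // => u v.
by rewrite -fD; congr (f (_, _)); rewrite /= addr0.
Qed.

Section Monomial.
Variables (k k' : G) (l l' : nat) (B a B' a' : K).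
Hypotheses (l_odd : odd l) (kl : k *+ l = 0) (k0 : k != 0).
Hypotheses (l'_odd : odd l') (k'l' : k' *+ l' = 0) (k'0 : k' != 0).
Hypotheses (B'0 : B' != 0) (a'0 : a' != 0) (a'c : frob c a' = a').
Hypothesis B'a' : frob k' a' * a' != frob k' (B' * frob c B').
Variables N L M : K * K -> K * K.
Hypotheses (ND : {morph N : X Y / X + Y}) (LD : {morph L : X Y / X + Y}).
Hypotheses (L_bij : bijective L) (M_bij : bijective M).
Hypothesis NLM : forall X Y, N (gk_mul frob c k B a X Y) = gk_mul frob c k' B' a' (L X) (M Y).

Let fstD (f : K * K -> K * K) : {morph f : X Y / X + Y} ->
  {morph (fun X => (f X).1) : X Y / X + Y}.
Proof. by move=> fD X Y; rewrite fD. Qed.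
Let sndD (f : K * K -> K * K) : {morph f : X Y / X + Y} ->
  {morph (fun X => (f X).2) : X Y / X + Y}.
Proof. by move=> fD X Y; rewrite fD. Qed.

(** The image under L of a vector of rank at most four has rank at most four:
every coordinate of its product with M Y is a combination of coordinates of the
product of the original vector with Y, by the expansion of N in powers of
Frobenius. *)
Lemma isotopism_probe e1 e2 e : e = 0 \/ e = c ->
  at_most_one (fun j => probe frob e1 e2 e (fun X => frob j (L X).1)) /\
  at_most_one (fun j => probe frob e1 e2 e (fun X => frob j (L X).2)).
Proof.
move=> ec; have [g spg] := probe_mul_span frobD frob_faithful c2 c0 B a l_odd kl k0 e1 e2 ec.
have [M' MK M'K] := M_bij.
have spN (f : K * K -> K) (fD : {morph f : X Y / X + Y}) j :
    inspan (fun i Y => g i (M' Y)) (fun Y => probe frob e1 e2 e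
      (fun X => frob j (f (gk_mul frob c k B a X (M' Y))))).
  suff [b gE] : inspan g (fun Y => probe frob e1 e2 e
      (fun X => frob j (f (gk_mul frob c k B a X Y)))).
    by exists b => Y; apply: gE.
  pose n i := coef frob i (fun x => f (x, 0)).
  pose n' i := coef frob i (fun y => f (0, y)).
  have [b gE] : inspan g (fun Y =>
      \sum_i frob j (n i) * probe frob e1 e2 e (fun X => frob (j + i) (gk_mul frob c k B a X Y).1) +
      \sum_i frob j (n' i) * probe frob e1 e2 e (fun X => frob (j + i) (gk_mul frob c k B a X Y).2)).
    by apply: inspanD; apply: inspan_sum => i; have [] := spg (j + i).
  exists b => Y; rewrite -gE -!(eq_bigr _ (fun i _ => probeZ _ _ _ _ _ _)) -!probe_sum -probeD.
  apply: eq_probe => X; rewrite (additive_frob2E fD) rmorphD !rmorph_sum.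
  by congr (_ + _); apply: eq_bigr => i _; rewrite rmorphM frobD.
pose xi j := probe frob e1 e2 e (fun X => frob j (L X).1).
pose eta j := probe frob e1 e2 e (fun X => frob j (L X).2).
have spF j : inspan (fun i Y => g i (M' Y)) (rowF frob k' B' xi eta j).
  have [b gE] := spN _ (fstD ND) j; exists b => Y; rewrite -gE.
  rewrite /rowF /xi /eta ![probe _ _ _ _ _ * _]mulrC -!probeZ -!probeD -probeZ -probeD.
  apply: eq_probe => X; rewrite NLM M'K /= !(rmorphD, rmorphM) -!frobD; ring.
have spG j : inspan (fun i Y => g i (M' Y)) (rowG frob k' c B' a' xi eta j).
  have [b gE] := spN _ (sndD ND) j; exists b => Y; rewrite -gE.
  rewrite /rowG /xi /eta ![probe _ _ _ _ _ * _]mulrC -!probeZ -!probeD -probeZ -probeD.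
  apply: eq_probe => X; rewrite NLM M'K /= !(rmorphD, rmorphM) -!frobD; ring.
split=> i j.
  by have [h _] := rank4_mono frobD frob_faithful c2 c0 l'_odd k'l' k'0 B'0 a'0 a'c B'a' i j spF spG.
by have [_ h] := rank4_mono frobD frob_faithful c2 c0 l'_odd k'l' k'0 B'0 a'0 a'c B'a' i j spF spG.
Qed.

(** The vectors X_0, Y_0, X_0 + Y_0 and X_0 + Y_c all have rank at most four, so
the conjugates of f have at most one nonzero value on each of them.  The first two
say that f has at most one term in x and at most one in y; together they cannot
both be present, by at_most_one_shift. *)
Lemma at_most_one_coef (f : K * K -> K) : {morph f : X Y / X + Y} ->
    (forall e1 e2 e, e = 0 \/ e = c ->
       at_most_one (fun j => probe frob e1 e2 e (fun X => frob j (f X)))) ->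
  exists s z, (forall X, f X = z * frob s X.1) \/ (forall X, f X = z * frob s X.2).
Proof.
move=> fD famo.
pose n i := coef frob i (fun x => f (x, 0)).
pose n' i := coef frob i (fun y => f (0, y)).
have probeE e1 e2 e j : probe frob e1 e2 e (fun X => frob j (f X)) =
    e1 * frob j (n (- j)) + e2 * frob j (n' (e - j)).
  by rewrite /probe !(coef_comp frobD) sub0r.
have n1 : at_most_one n.
  move=> i j ni nj; apply: oppr_inj; apply: (famo 1 0 0 (or_introl erefl));
  by rewrite probeE mul1r mul0r addr0 frob_eq0 opprK.
have n'1 : at_most_one n'.
  move=> i j ni nj; apply: oppr_inj; apply: (famo 0 1 0 (or_introl erefl));
  by rewrite probeE mul1r mul0r add0r frob_eq0 sub0r opprK.
have nn' e : e = 0 \/ e = c -> at_most_one (fun i => n i + n' (e + i)).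
  move=> ec i j ni nj; apply: oppr_inj; apply: (famo 1 1 e ec);
  by rewrite probeE !mul1r -rmorphD frob_eq0 opprK.
have [||n0|n'0] := at_most_one_shift c2 c0 n1 n'1.
- by move=> i j; rewrite -[in n' i](add0r i) -[in n' j](add0r j); apply: nn'; left.
- by apply: nn'; right.
- have sum0 x : \sum_i n i * frob i x = 0 by apply: big1 => i _; rewrite n0 mul0r.
  have [/existsP[s n's]|/existsPn n'0] := boolP [exists i, n' i != 0].
    exists s, (n' s); right=> X.
    by rewrite (additive_frob2E fD) sum0 add0r (at_most_one_sum frob n'1 n's).
  exists 0, 0; left=> X; rewrite (additive_frob2E fD) sum0 add0r mul0r.
  by apply: big1 => i _; rewrite [coef _ _ _](eqP (negPn (n'0 i))) mul0r.
have sum0 x : \sum_i n' i * frob i x = 0 by apply: big1 => i _; rewrite n'0 mul0r.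
have [/existsP[s ns]|/existsPn n0] := boolP [exists i, n i != 0].
  exists s, (n s); left=> X.
  by rewrite (additive_frob2E fD) sum0 addr0 (at_most_one_sum frob n1 ns).
exists 0, 0; left=> X; rewrite (additive_frob2E fD) sum0 addr0 mul0r.
by apply: big1 => i _; rewrite [coef _ _ _](eqP (negPn (n0 i))) mul0r.
Qed.

Definition diagonal (s t : G) (al de : K) (f : K * K -> K * K) :=
  forall X, f X = (al * frob s X.1, de * frob t X.2).
Definition antidiagonal (s t : G) (al de : K) (f : K * K -> K * K) :=
  forall X, f X = (de * frob t X.2, al * frob s X.1).

(** Bijectivity of L excludes that both components depend on the same variable. *)
Lemma isotopism_monomial : exists s t al de, [/\ al != 0, de != 0 &
  diagonal s t al de L \/ antidiagonal s t al de L].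
Proof.
have [s [al f1]] := at_most_one_coef (fstD LD) (fun e1 e2 e ec => (isotopism_probe e1 e2 ec).1).
have [t [de f2]] := at_most_one_coef (sndD LD) (fun e1 e2 e ec => (isotopism_probe e1 e2 ec).2).
have [L' LK L'K] := L_bij.
have al0 : al != 0.
  apply: contra_eqN (congr1 fst (L'K (1, 0))) => /eqP al0.
  by case: f1 => ->; rewrite al0 mul0r eq_sym oner_eq0.
have de0 : de != 0.
  apply: contra_eqN (congr1 snd (L'K (0, 1))) => /eqP de0.
  by case: f2 => ->; rewrite de0 mul0r eq_sym oner_eq0.
have L0 : L 0 = 0 by apply: (addIr (L 0)); rewrite -LD !add0r.
have pairE (Z : K * K) : Z = (Z.1, Z.2) by case: Z.
case: f1 f2 => f1 [] f2.
- have : L (0, 1) = L 0.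
    by rewrite L0 [LHS]pairE f1 f2 /= !rmorph0 !mulr0.
  by move/(can_inj LK) => -[/eqP]; rewrite oner_eq0.
- exists s, t, al, de; split=> //; left=> X; by rewrite [LHS]pairE f1 f2.
- exists t, s, de, al; split=> //; right=> X; by rewrite [LHS]pairE f1 f2.
- have : L (1, 0) = L 0.
    by rewrite L0 [LHS]pairE f1 f2 /= !rmorph0 !mulr0.
  by move/(can_inj LK) => -[/eqP]; rewrite oner_eq0.
Qed.
End Monomial.
End Isotopism.

(** * Comparison of coefficients *)

Section Compare.
Variables (K : finFieldType) (G : finComNzRingType).
Variable frob : G -> {rmorphism K -> K}.
Hypothesis frobD : forall i j x, frob (i + j) x = frob i (frob j x).
Hypothesis frob_faithful : forall i j, i != j -> exists x, frob i x != frob j x.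
Variable p : nat.
Hypotheses (pK : p \in [pchar K]) (cardK : #|K| = (p ^ #|G|)%N).

(** The coefficient of frob i x * frob j u in f x u. *)
Definition bicoef (i j : G) (f : K -> K -> K) : K :=
  coef frob i (fun x => coef frob j (f x)).

Lemma eq_bicoef i j f g : (forall x u, f x u = g x u) -> bicoef i j f = bicoef i j g.
Proof. by move=> fg; apply: eq_coef => x; apply: eq_coef => u. Qed.

Lemma bicoefD i j f g : bicoef i j (fun x u => f x u + g x u) = bicoef i j f + bicoef i j g.
Proof. by rewrite /bicoef -frob_coefD; apply: eq_coef => x; apply: frob_coefD. Qed.

Lemma bicoef_sum i j (I : finType) (f : I -> K -> K -> K) :
  bicoef i j (fun x u => \sum_t f t x u) = \sum_t bicoef i j (f t).
Proof. by rewrite /bicoef -frob_coef_sum; apply: eq_coef => x; apply: frob_coef_sum. Qed.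

Lemma bicoef_frob i j P i' j' :
  bicoef i j (fun x u => P * (frob i' x * frob j' u)) = P * (i == i')%:R * (j == j')%:R.
Proof.
rewrite /bicoef (eq_coef _ _ (g := fun x => P * (j == j')%:R * frob i' x)) => [|x].
  by rewrite frob_coefZ (coef_frob frob_faithful); ring.
rewrite (eq_coef _ _ (g := fun u => P * frob i' x * frob j' u)) => [|u]; last by ring.
by rewrite frob_coefZ (coef_frob frob_faithful); ring.
Qed.

Lemma eqDself (i j : G) : (i == i + j) = (j == 0).
Proof. by rewrite -{1}[i]addr0 (inj_eq (addrI i)) eq_sym. Qed.

Lemma eqDself2 (i h : G) : h + h != 0 -> (i == i + h + h) = false.
Proof. by move=> hh; rewrite -addrA eqDself (negPf hh). Qed.

Lemma bicoef_two i j P Q i1 j1 i2 j2 :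
  bicoef i j (fun x u => P * (frob i1 x * frob j1 u) + Q * (frob i2 x * frob j2 u)) =
  P * (i == i1)%:R * (j == j1)%:R + Q * (i == i2)%:R * (j == j2)%:R.
Proof. by rewrite bicoefD !bicoef_frob. Qed.

(** A symmetric sum of two monomials with exponents (s + h, s') and (s, s' + h):
swapping must fix each pair or exchange them, and 2 h <> 0 leaves s = s'. *)
Lemma symmetric_two P Q s s' h : P != 0 -> Q != 0 -> h + h != 0 ->
    (forall x u, P * (frob (s + h) x * frob s' u) + Q * (frob s x * frob (s' + h) u) =
                 P * (frob (s + h) u * frob s' x) + Q * (frob s u * frob (s' + h) x)) ->
  s = s' /\ P = Q.
Proof.
move=> P0 Q0 hh sym.
have h0 : (h == 0) = false by apply: contraNF hh => /eqP->; rewrite addr0.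
have co2E i j : P * (i == s + h)%:R * (j == s')%:R + Q * (i == s)%:R * (j == s' + h)%:R =
    P * (i == s')%:R * (j == s + h)%:R + Q * (i == s' + h)%:R * (j == s)%:R.
  by rewrite -!bicoef_two; apply: eq_bicoef => x u; rewrite sym; ring.
have ss' : s = s'.
  apply: contrapT => /eqP/negPf ss'.
  have := co2E (s + h) s'; rewrite !eqxx (inj_eq (addIr h)) ss' [s' == s]eq_sym ss'.
  rewrite [s + h == s]eq_sym eqDself h0 !(mulr0, mul0r, addr0).
  rewrite !mulr1; have [s'E _|_] := eqVneq s' (s + h); last first.
    by rewrite mulr0 => /eqP; rewrite (negPf P0).
  have := co2E s (s' + h); rewrite !eqxx s'E eqDself h0 eqDself2 // !(mulr0, mul0r, mulr1, addr0, add0r).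
  by move/eqP; rewrite (negPf Q0).
split=> //; have := co2E (s + h) s; rewrite -ss' !eqxx ![s + h == s]eq_sym eqDself h0.
by rewrite !(mulr0, mul0r, mulr1, addr0, add0r).
Qed.

Lemma bicoef_twist (g : K -> K) h w i : {morph g : x y / x + y} -> h + h != 0 ->
  bicoef (i + h) i (fun x u => g (frob h x * u + w * (x * frob h u))) = coef frob i g /\
  bicoef i (i + h) (fun x u => g (frob h x * u + w * (x * frob h u))) = coef frob i g * frob i w.
Proof.
move=> gD hh.
have h0 : (h == 0) = false by apply: contraNF hh => /eqP->; rewrite addr0.
have E x u : g (frob h x * u + w * (x * frob h u)) = \sum_j (coef frob j g * (frob (j + h) x * frob j u)
    + coef frob j g * frob j w * (frob j x * frob (j + h) u)).
  rewrite (additive_frobE frob_faithful pK cardK gD); apply: eq_bigr => j _.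
  by rewrite !(rmorphD, rmorphM) -!frobD; ring.
split; rewrite (eq_bicoef _ _ E) bicoef_sum (bigD1 i) //= bicoef_two !eqxx eqDself h0.
  rewrite big1 => [|j ji]; first by rewrite !(mulr1, mul0r, mulr0, addr0).
  rewrite bicoef_two (inj_eq (addIr h)) eq_sym (negPf ji).
  have [<-|] := eqVneq (i + h) j; last by rewrite !(mulr0, mul0r, addr0).
  by rewrite eqDself2 // !(mulr0, mul0r, addr0).
rewrite big1 => [|j ji]; first by rewrite !(mulr1, mul0r, mulr0, addr0, add0r).
rewrite bicoef_two (inj_eq (addIr h)) [i == j]eq_sym (negPf ji).
have [->|] := eqVneq i (j + h); last by rewrite !(mulr0, mul0r, addr0).
by rewrite [_ == j]eq_sym eqDself2 // !(mulr0, mul0r, addr0).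
Qed.

Variable c : G.
Hypotheses (c2 : c + c = 0).

Definition norm_c (x : K) : K := x * frob c x.
(** The invariant of the isotopy class, up to Galois conjugation and inversion. *)
Definition theta (k : G) (B a : K) : K := frob k a * a / frob k (norm_c B).

(** The hypotheses are the coefficient equations of a diagonal isotopism.  With
z = al' / al, e = de' / de and w = de / al they say that z and e are fixed by
frob k and exchanged by frob c, that B^s / B' = (e / z) w^k w and that
a' = a^s / (w w^c)^k.  In theta the norms of w cancel, and e / z has norm 1. *)
Lemma theta_twist k s B a B' a' al de al' de' :
    B != 0 -> a != 0 -> B' != 0 -> a' != 0 ->
    al != 0 -> de != 0 -> al' != 0 -> de' != 0 ->
    frob k al * al' = al * frob k al' -> frob k de * de' = de * frob k de' ->
    frob k al * al' * frob s B = B' * (frob k de * de') ->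
    frob (k + c) al * de' = frob (k + c) al' * de ->
    frob (k + c) al * de' * frob s (a / B) = a' / B' * (al * frob (k + c) de') ->
  theta k B' a' = frob s (theta k B a).
Proof.
move=> B0 a0 B'0 a'0 al0 de0 al'0 de'0.
have fr0 i x : x != 0 -> frob i x != 0 by rewrite frob_eq0.
pose z := al' / al; pose e := de' / de; pose w := de / al.
have z0 : z != 0 by rewrite mulf_neq0 ?invr_neq0.
have e0 : e != 0 by rewrite mulf_neq0 ?invr_neq0.
have w0 : w != 0 by rewrite mulf_neq0 ?invr_neq0.
have -> : de' = e * (w * al) by rewrite /e /w; field; rewrite al0.
have -> : al' = z * al by rewrite /z; field.
have -> : de = w * al by rewrite /w; field.
clearbody z e w.
have swap i j x : frob i (frob j x) = frob j (frob i x) by rewrite -!frobD addrC.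
have cc x : frob c (frob c x) = x by rewrite -frobD c2 (frob0 frobD).
rewrite !(frobD k c) !rmorphM /=.
have fal i := fr0 i _ al0; have fw i := fr0 i _ w0.
have fz i := fr0 i _ z0; have fe i := fr0 i _ e0.
move=> Hz He.
have kz : frob k z = z.
  by apply: (mulfI (mulf_neq0 (fal k) al0));
    rewrite (_ : _ * z = frob k al * (z * al)); [rewrite Hz|]; ring.
have ke : frob k e = e.
  apply: (mulfI (mulf_neq0 (mulf_neq0 (fw k) (fal k)) (mulf_neq0 w0 al0))).
  by rewrite (_ : _ * e = frob k w * frob k al * (e * (w * al))); [rewrite He|]; ring.
have fkc x : x != 0 -> frob k (frob c x) != 0 by move=> x0; rewrite !fr0.
have kc i x : frob k (frob i x) = frob i (frob k x) := swap k i x.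
rewrite (kc c z) (kc c e) kz ke => HB Hd.
have ez : e = frob c z.
  by apply: (mulfI (mulf_neq0 (mulf_neq0 (fkc _ al0) w0) al0));
    rewrite (_ : _ * e = frob k (frob c al) * (e * (w * al))); [rewrite Hd|]; ring.
have zE : frob c e = z by rewrite ez cc.
rewrite zE fmorphV => Ha.
have {}HB : frob s B = B' * e / z * (frob k w * w).
  apply: (mulfI (mulf_neq0 (mulf_neq0 z0 (fal k)) al0)).
  rewrite (_ : _ * frob s B = frob k al * (z * al) * frob s B); last by ring.
  by rewrite HB; field.
have {}Ha : a' = frob s a / (frob k w * frob k (frob c w)).
  have : frob k (frob c al) * (e * (w * al)) * (frob s a / frob s B) =
         a' / B' * (al * (z * (frob k (frob c w) * frob k (frob c al)))) by [].
  rewrite HB => h.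
  have H0 : (al * (z * (frob k (frob c w) * frob k (frob c al)))) / B' != 0.
    by rewrite !mulf_neq0 ?invr_neq0 ?fkc.
  apply: (mulIf H0).
  rewrite (_ : a' * _ =
    a' / B' * (al * (z * (frob k (frob c w) * frob k (frob c al))))); last by ring.
  by rewrite -h; field; rewrite ?fkc ?fw ?z0 ?e0 ?w0 ?B'0.
rewrite /theta /norm_c !(rmorphM, fmorphV) /=.
rewrite [frob s (frob k a)]swap [frob s (frob k B)]swap.
rewrite [frob s (frob k (frob c B))]swap [frob s (frob c B)]swap HB Ha.
rewrite !(rmorphM, fmorphV) /= -ez zE kz ke [frob c (frob k w)]swap.
by field; rewrite ?fkc ?fr0 ?z0 ?e0 ?w0 ?B'0.
Qed.

Section Diagonal.
Variables (k k' : G) (B a B' a' : K).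
Hypotheses (kk : k + k != 0) (kk' : k' + k' != 0) (kNk' : k != - k').
Hypotheses (B0 : B != 0) (a0 : a != 0) (B'0 : B' != 0) (a'0 : a' != 0).
Hypothesis two0 : 2%:R != 0 :> K.
Variables N L M : K * K -> K * K.
Hypothesis ND : {morph N : X Y / X + Y}.
Hypothesis NLM : forall X Y, N (gk_mul frob c k B a X Y) = gk_mul frob c k' B' a' (L X) (M Y).
Variables (s t s' t' : G) (al de al' de' : K).
Hypotheses (al0 : al != 0) (de0 : de != 0) (al'0 : al' != 0) (de'0 : de' != 0).

(** The products (x, 0) * (u, 0), (0, x) * (0, u), (x, 0) * (0, u) and
(0, x) * (u, 0) give the four groups of equations.  The first one shows that the
first component of N (z, 0) is a monomial and that k = k' or k = - k'; the
others show that all Frobenius exponents are equal to s. *)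
Lemma diagonal_theta : diagonal frob s t al de L -> diagonal frob s' t' al' de' M ->
  k = k' /\ theta k' B' a' = frob s (theta k B a).
Proof.
move=> LE ME.
have fr0 i x : x != 0 -> frob i x != 0 by rewrite frob_eq0.
pose g1 z := (N (z, 0)).1; pose g2 z := (N (0, z)).2.
have g1D : {morph g1 : x y / x + y}.
  by move=> x y; rewrite -[RHS]/((N (x, 0) + N (y, 0)).1) -ND; congr (N (_, _)).1; rewrite /= addr0.
have g2D : {morph g2 : x y / x + y}.
  by move=> x y; rewrite -[RHS]/((N (0, x) + N (0, y)).2) -ND; congr (N (_, _)).2; rewrite /= addr0.
have NE X Y : N (gk_mul frob c k B a X Y) = gk_mul frob c k' B' a'
    (al * frob s X.1, de * frob t X.2) (al' * frob s' Y.1, de' * frob t' Y.2).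
  by rewrite NLM LE ME.
pose P := frob k' al * al'; pose Q := al * frob k' al'.
have P0 : P != 0 by rewrite mulf_neq0 ?fr0.
have Q0 : Q != 0 by rewrite mulf_neq0 ?fr0.
have E1 x u : g1 (frob k x * u + 1 * (x * frob k u)) =
    P * (frob (s + k') x * frob s' u) + Q * (frob s x * frob (s' + k') u).
  transitivity (N (gk_mul frob c k B a (x, 0) (u, 0))).1.
    by congr (N (_, _)).1; rewrite /= !rmorph0; ring.
  by rewrite NE /= !(rmorphM, rmorph0) [s + _]addrC [s' + _]addrC !frobD /P /Q; ring.
have [ss' PQ] : s = s' /\ P = Q.
  apply: (symmetric_two P0 Q0 kk') => x u; rewrite -!E1; congr g1; ring.
move: E1; rewrite -ss' -PQ => E1.
have nE i : coef frob i g1 = P * (i + k == s + k')%:R * (i == s)%:R +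
    P * (i + k == s)%:R * (i == s + k')%:R.
  by rewrite -bicoef_two -(bicoef_twist 1 i g1D kk).1; apply: eq_bicoef.
have k'0 : (k' == 0) = false by apply: contraNF kk' => /eqP->; rewrite addr0.
have g1E z : g1 z = \sum_i coef frob i g1 * frob i z := additive_frobE frob_faithful pK cardK g1D z.
have kk'E : k = k'.
  apply: contrapT => kk'E.
  have : g1 (frob k 1 * 1 + 1 * (1 * frob k 1)) != 0.
    by rewrite E1 !rmorph1 !mulr1 -[P]mulr1 -mulrDr mulf_neq0.
  rewrite g1E big1 ?eqxx // => i _; rewrite nE.
  have [->|_] := eqVneq i s.
    by rewrite (inj_eq (addrI s)) (introF eqP kk'E) eqDself k'0 !(mulr0, mul0r, addr0).
  have [->|_] := eqVneq i (s + k'); last by rewrite !(mulr0, mul0r, addr0).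
  by rewrite -addrA [_ == s]eq_sym eqDself [k' + k]addrC addr_eq0 (negPf kNk') !(mulr0, mul0r, addr0).
rewrite -kk'E in P P0 Q Q0 PQ E1 k'0 nE *.
have k0 : (k == 0) = false := k'0.
have {}nE i : coef frob i g1 = P *+ (i == s).
  rewrite nE (inj_eq (addIr k)) -mulrA -natrM mulnb andbb mulr_natr.
  have [->|_] := eqVneq i (s + k); last by rewrite mulr0 addr0.
  by rewrite [s + k == s]eq_sym [s + k + k == s]eq_sym eqDself k0 eqDself2 // !(mulr0, mul0r, addr0).
have {}g1E z : g1 z = P * frob s z.
  rewrite g1E (bigD1 s) //= nE eqxx mulr1n big1 ?addr0 // => i /negPf ins.
  by rewrite nE ins mul0r.
pose R := B' * (frob k de * de'); pose S := B' * (de * frob k de').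
have R0 : R != 0 by rewrite !mulf_neq0 ?fr0.
have S0 : S != 0 by rewrite !mulf_neq0 ?fr0.
have E2 x u : P * frob s B * (frob (s + k) x * frob s u) + P * frob s B * (frob s x * frob (s + k) u) =
    R * (frob (t + k) x * frob t' u) + S * (frob t x * frob (t' + k) u).
  transitivity (N (gk_mul frob c k B a (0, x) (0, u))).1.
    rewrite !frobD -[RHS]/((N (_, _)).1) /= !(mul0r, mulr0, rmorph0, addr0, add0r).
    by rewrite -[RHS]/(g1 _) g1E !(rmorphM, rmorphD); ring.
  by rewrite NE -kk'E /= !(rmorphM, rmorph0) [t + _]addrC [t' + _]addrC !frobD /R /S; ring.
have [tt' RS] : t = t' /\ R = S.
  by apply: (symmetric_two R0 S0 kk) => x u; rewrite -!E2; ring.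
have co2E2 i j := etrans (esym (bicoef_two i j _ _ _ _ _ _))
  (etrans (eq_bicoef i j E2) (bicoef_two i j _ _ _ _ _ _)).
have [ts PR] : t = s /\ P * frob s B = R.
  have := co2E2 (s + k) s; rewrite -tt' (inj_eq (addIr k)) !eqxx eqDself k0.
  rewrite [s + k == s]eq_sym eqDself k0 !(mulr0, mulr1, mul0r, addr0).
  have [<-|ne] := eqVneq s t; first by rewrite eqxx eqDself k0 !(mulr1, mulr0, addr0).
  rewrite !(mulr0, add0r).
  have [<-|_] := eqVneq (s + k) t; last first.
    by rewrite !(mulr0, mul0r) => /eqP; rewrite mulf_eq0 (negPf P0) /= frob_eq0 (negPf B0).
  by rewrite eqDself2 // mulr0 => /eqP; rewrite mulf_eq0 (negPf P0) /= frob_eq0 (negPf B0).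
have hh : k + c + (k + c) != 0 by rewrite addrACA c2 addr0.
pose A := a / B; pose A' := a' / B'.
have E3 x u : g2 (frob (k + c) x * u + A * (x * frob (k + c) u)) =
    frob (k + c) al * de' * (frob (s + (k + c)) x * frob s u) +
    A' * (al * frob (k + c) de') * (frob s x * frob (s + (k + c)) u).
  transitivity (N (gk_mul frob c k B a (x, 0) (0, u))).2.
    by congr (N (_, _)).2; rewrite /= !rmorph0 /A; ring.
  by rewrite NE -kk'E -tt' ts /= !(rmorphM, rmorph0) ![s + _]addrC !frobD /A'; ring.
have E4 x u : g2 (frob (k + c) u * x + A * (u * frob (k + c) x)) =
    frob (k + c) al' * de * (frob (s + (k + c)) u * frob s x) +
    A' * (al' * frob (k + c) de) * (frob s u * frob (s + (k + c)) x).
  transitivity (N (gk_mul frob c k B a (0, x) (u, 0))).2.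
    by congr (N (_, _)).2; rewrite /= !rmorph0 /A; ring.
  by rewrite NE -kk'E -ss' ts /= !(rmorphM, rmorph0) ![s + _]addrC !frobD /A'; ring.
have h0 : (k + c == 0) = false.
  by apply: contraNF hh => /eqP->; rewrite addr0.
have [n1 n2] := bicoef_twist A s g2D hh.
move: n1 n2; rewrite !(eq_bicoef _ _ E3) !bicoef_two !eqxx eqDself [_ == s]eq_sym eqDself h0.
rewrite !(mulr1, mulr0, mul0r, addr0, add0r) => n1 n2.
have [n3 _] := bicoef_twist A s g2D hh.
move: n3; rewrite (eq_bicoef _ _ (fun x u => E4 u x)) !bicoef_two !eqxx eqDself [_ == s]eq_sym eqDself h0.
rewrite !(mulr1, mulr0, mul0r, addr0, add0r) => n3.
split=> //; apply: (@theta_twist k s B a B' a' al de al' de') => //.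
- by apply: (mulfI B'0); rewrite -/R RS /S.
- by rewrite n1 n3.
- by rewrite n1 -n2.
Qed.
End Diagonal.

End Compare.

(** * Absence of zero divisors *)

Section Planar.
Variables (K : finFieldType) (G : finComNzRingType).
Variable frob : G -> {rmorphism K -> K}.
Hypothesis frobD : forall i j x, frob (i + j) x = frob i (frob j x).
Variables (c : G) (Q : nat).
Hypothesis c2 : c + c = 0.
Hypotheses (Q_odd : odd Q) (cardQ : #|K| = (Q ^ 2)%N).
Hypothesis frobc : forall x, frob c x = x ^+ Q.

(** The quadratic character: the exponent is (Q ^ 2 - 1) / 2. *)
Definition chi (x : K) : K := x ^+ (Q./2 * Q.+1).

Lemma chiM x y : chi (x * y) = chi x * chi y.
Proof. exact: exprMn. Qed.

Lemma chiV x : chi x^-1 = (chi x)^-1.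
Proof. exact: exprVn. Qed.

Lemma chi_sqr x : x != 0 -> chi x * chi x = 1.
Proof.
move=> x0; rewrite /chi -exprD addnn -mul2n mulnA mul2n.
have -> : (Q./2.*2 * Q.+1 = #|K|.-1)%N.
  by rewrite cardQ -{2 3}(odd_double_half Q) Q_odd; lia.
apply: (mulfI x0); rewrite -exprS prednK ?mulr1 ?expf_card //.
exact: ltnW (finNzRing_gt1 K).
Qed.

Lemma chi_pm x : x != 0 -> chi x = 1 \/ chi x = -1.
Proof.
move=> /chi_sqr /eqP; rewrite -expr2 sqrf_eq1 => /orP[] /eqP ->; by [left | right].
Qed.

Lemma chi_frob i x : x != 0 -> chi (frob i x) = chi x.
Proof.
move=> x0; rewrite /chi -rmorphXn -/(chi x).
by have [->|->] := chi_pm x0; rewrite ?rmorphN rmorph1.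
Qed.

Lemma frobc_expE x : x != 0 -> frob c x = x -> x ^+ Q./2.*2 = 1.
Proof.
move=> x0 xc; apply: (mulfI x0); rewrite mulr1 -exprS -[RHS]xc frobc.
by rewrite -add1n -[X in (X + _)%N]/(nat_of_bool true) -Q_odd odd_double_half.
Qed.

(** Elements of the subfield with Q elements are squares. *)
Lemma chi_fix x : x != 0 -> frob c x = x -> chi x = 1.
Proof.
move=> x0 /(frobc_expE x0) xE; rewrite /chi.
have -> : (Q./2 * Q.+1 = Q./2.*2 * Q./2.+1)%N.
  by rewrite -{2}(odd_double_half Q) Q_odd; lia.
by rewrite exprM xE expr1n.
Qed.

Lemma chiN x : chi (- x) = chi x.
Proof.
by rewrite -mulN1r chiM chi_fix ?mul1r // ?oppr_eq0 ?oner_eq0 // rmorphN1.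
Qed.

(** B is not a square and a is a nonzero element of the subfield. *)
Definition admissible (k : G) (B a : K) : Prop :=
  [/\ exists2 l, odd l & k *+ l = 0, k != 0, a != 0, frob c a = a
    & B != 0 /\ chi B != 1].

(** The norm of B is not a square in the subfield with Q elements, whereas
frob k a * a is one, a and frob k a having the same quadratic character there. *)
Lemma admissible_norm k B a : admissible k B a ->
  frob k a * a != frob k (B * frob c B).
Proof.
move=> [_ _ a0 ac [B0 chiB]]; apply: contraNneq chiB => e.
have aE := frobc_expE a0 ac.
have {}e := congr1 (fun x => x ^+ Q./2) e; move: e.
have y2 : a ^+ Q./2 * a ^+ Q./2 = 1 by rewrite -exprD addnn.
have fy : frob k (a ^+ Q./2) = a ^+ Q./2.
  move/eqP: y2; rewrite -expr2 sqrf_eq1 => /orP[] /eqP ->;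
  by rewrite ?rmorphN rmorph1.
rewrite exprMn -(rmorphXn (frob k) _ a) fy y2 -rmorphXn frobc -exprS -exprM mulnC.
by rewrite -/(chi B) => e; rewrite -(fmorph_eq1 (frob k)) -e.
Qed.

Section NoZeroDivisors.
Variables (k : G) (B a : K).
Hypothesis adm : admissible k B a.

Hypothesis two0 : 2%:R != 0 :> K.

(** Iterating frob k w = - w an odd number l of times gives w = - w. *)
Lemma frob_antifixed w : w + frob k w = 0 -> w = 0.
Proof.
have [[l l_odd kl] _ _ _ _] := adm => /eqP; rewrite addrC addr_eq0 => /eqP kw.
have kn n : frob (k *+ n) w = (-1) ^+ n * w.
  elim: n => [|n IH]; first by rewrite mulr0n expr0 mul1r (frob0 frobD).
  by rewrite mulrSr frobD kw rmorphN IH exprS mulN1r mulNr.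
have := kn l; rewrite kl (frob0 frobD) -signr_odd l_odd expr1 mulN1r => /eqP.
by rewrite -subr_eq0 opprK -mulr2n -mulr_natl mulf_eq0 (negPf two0) => /eqP.
Qed.

Lemma polar_eq0 x u : x != 0 -> frob k x * u + x * frob k u = 0 -> u = 0.
Proof.
move=> x0 e; have fx0 : frob k x != 0 by rewrite frob_eq0.
have /eqP : u / x = 0.
  apply: frob_antifixed; rewrite rmorphM fmorphV.
  apply: (mulfI (mulf_neq0 fx0 x0)); rewrite mulr0 -[RHS]e; by field; apply/andP.
by rewrite mulf_eq0 invr_eq0 (negPf x0) orbF => /eqP.
Qed.

Lemma chi_div : chi (a / B) != 1.
Proof.
have [_ _ a0 ac [B0 chiB]] := adm.
by rewrite chiM chiV (chi_fix a0 ac) mul1r invr_eq1.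
Qed.

Lemma chi_neq0 x : x != 0 -> chi x != 0.
Proof. exact: expf_neq0. Qed.

(** The quotient of the two sides has quadratic character chi B. *)
Lemma twist_neq h x v : x != 0 -> v != 0 ->
  frob h x * v != a / B * (x * frob h v).
Proof.
move=> x0 v0; apply: contraNneq chi_div => /(congr1 chi).
rewrite !chiM !chi_frob // -{1}[chi x * _]mul1r -chiM => /mulIf -> //.
by rewrite chi_neq0 ?mulf_neq0.
Qed.

Lemma twist_eq0 h x v : x != 0 ->
  frob h x * v + a / B * (x * frob h v) = 0 -> v = 0.
Proof.
move=> x0 /eqP; apply: contraTeq => v0; rewrite addr_eq0.
apply: contraNneq chi_div => /(congr1 chi).
rewrite chiN !chiM !chi_frob // -{1}[chi x * _]mul1r -chiM => /mulIf -> //.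
by rewrite chi_neq0 ?mulf_neq0.
Qed.

(** The equations of a zero product of vectors with nonzero coordinates, after
division.  With Z = frob c z, the two products (w + w^k) (Z + Z^k) and
(w + Z^k) (Z + w^k) both lie in b L, and they differ by (w - Z) (w - Z)^k up to
sign.  So this square lies in b L, which forces w = Z as b is not a square; then
w + w^k is both b times z + z^k and the conjugate of z + z^k, hence zero. *)
Lemma generic_eq0 (w z b d : K) : b != 0 -> chi b != 1 -> frob c d = d ->
    w + frob k w = b * (z + frob k z) ->
    b * (z + frob (k + c) w) = d * (w + frob (k + c) z) ->
  w = 0 /\ z = 0.
Proof.
move=> b0 chib dc e1 e2.
have cc x : frob c (frob c x) = x by rewrite -frobD c2 (frob0 frobD).
have kc x : frob c (frob k x) = frob k (frob c x) by rewrite -!frobD addrC.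
rewrite !frobD in e2.
set Z := frob c z in e2.
pose P := w + frob k Z; pose T := z + frob k z.
pose m := T * frob c T - d * (P * frob c P) / (b * frob c b).
have fb0 : frob c b != 0 by rewrite frob_eq0.
have mc : frob c m = m.
  rewrite /m rmorphB !rmorphM fmorphV !rmorphM !cc dc.
  by congr (_ - _); [exact: mulrC | congr (d * _ / _); exact: mulrC].
have PR : Z + frob k w = d * frob c P / frob c b.
  apply: (mulfI fb0); rewrite [RHS]mulrC divfK //.
  transitivity (frob c (b * (z + frob k (frob c w)))).
    by rewrite rmorphM rmorphD kc cc.
  by rewrite e2 rmorphM dc.
have key : - ((w - Z) * frob k (w - Z)) = b * m.
  transitivity ((w + frob k w) * (Z + frob k Z) - P * (Z + frob k w)).
    by rewrite /P rmorphB; ring.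
  have fT : frob c T = Z + frob k Z by rewrite rmorphD kc.
  by rewrite e1 -/T PR /m fT; field; apply/andP.
have chi1 x : x != 0 -> chi (x * frob k x) = 1.
  by move=> x0; rewrite chiM chi_frob // chi_sqr.
have [wZ|wZ] := eqVneq w Z; last first.
  have wZ0 : w - Z != 0 by rewrite subr_eq0.
  have m0 : m != 0.
    apply: contra_eqN key => /eqP->; rewrite mulr0 oppr_eq0 mulf_eq0 frob_eq0.
    by rewrite orbb.
  case/negP: chib; apply/eqP; have := congr1 chi key.
  by rewrite chiN chi1 // chiM (chi_fix m0 mc) mulr1.
have zw : z = frob c w by rewrite wZ cc.
have T0 : T = 0.
  apply: contraNeq chib => T0; apply/eqP.
  have /(congr1 chi) : frob c T = b * T by rewrite -e1 /T rmorphD kc -/Z wZ.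
  rewrite chiM chi_frob // -{1}[chi T]mul1r => /mulIf -> //.
  exact: chi_neq0.
have z0 := frob_antifixed T0.
by rewrite wZ /Z z0 rmorph0.
Qed.

(** If a coordinate of X vanishes the equations decouple.  Otherwise put
w = u / x, z = v / y, t = y / x and apply generic_eq0 with b = - B t^k t and
d = a (t t^c)^k. *)
Lemma gk_mul_eq0 X Y : gk_mul frob c k B a X Y = 0 -> X = 0 \/ Y = 0.
Proof.
have [_ _ a0 ac [B0 chiB]] := adm.
case: X Y => [x y] [u v] [/= e1 e2].
have [x0|x0] := eqVneq x 0; have [y0|y0] := eqVneq y 0.
- by left; rewrite x0 y0.
- right; move: e1 e2; rewrite x0 !rmorph0 !mul0r !add0r => /eqP.
  rewrite mulf_eq0 (negPf B0) /= => /eqP /(polar_eq0 y0) v0 e2.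
  suff -> : u = 0 by rewrite v0.
  by apply: contraNeq y0 => /twist_eq0 y0; apply/eqP/(y0 (k + c)).
- right; move: e1 e2; rewrite y0 !rmorph0 !(mul0r, mulr0, addr0).
  by move=> /(polar_eq0 x0) -> /(twist_eq0 x0) ->.
right; pose t := y / x; pose w := u / x; pose z := v / y.
have uE : u = w * x by rewrite /w divfK.
have vE : v = z * y by rewrite /z divfK.
have yE : y = t * x by rewrite /t divfK.
have t0 : t != 0 by rewrite mulf_neq0 ?invr_neq0.
clearbody t w z; subst u v.
have fr0 i s : s != 0 -> frob i s != 0 by rewrite frob_eq0.
pose b := - (B * (frob k t * t)).
have b0 : b != 0 by rewrite oppr_eq0 !mulf_neq0 ?fr0.
have chib : chi b != 1.
  by rewrite chiN !chiM chi_frob // chi_sqr // mulr1.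
have [||| w0 z0] := @generic_eq0 w z b (a * frob k (t * frob c t)) b0 chib.
- by rewrite rmorphM ac -frobD addrC frobD rmorphM -frobD c2 (frob0 frobD) [t * _]mulrC.
- apply: (mulfI (mulf_neq0 (fr0 k _ x0) x0)); apply/eqP; rewrite -subr_eq0; apply/eqP.
  by rewrite -[RHS]e1 yE /b !rmorphM; ring.
- apply: (mulfI (mulf_neq0 (fr0 (k + c) _ x0) x0)); apply/eqP; rewrite -subr_eq0; apply/eqP.
  transitivity (- (B * frob k t) * (frob (k + c) x * (z * y) + frob (k + c) (w * x) * y +
      a / B * (x * frob (k + c) (z * y) + w * x * frob (k + c) y))); last by rewrite e2 mulr0.
  by rewrite yE /b !rmorphM !frobD; field.
by rewrite w0 z0 !mul0r.
Qed.
End NoZeroDivisors.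
End Planar.

(** * The isotopy invariant *)

Section Isotopic.
Variables (K : finFieldType) (G : finComNzRingType).
Variable frob : G -> {rmorphism K -> K}.
Hypothesis frobD : forall i j x, frob (i + j) x = frob i (frob j x).
Hypothesis frob_faithful : forall i j, i != j -> exists x, frob i x != frob j x.
Variable p : nat.
Hypotheses (pK : p \in [pchar K]) (cardK : #|K| = (p ^ #|G|)%N).
Variables (c : G) (Q : nat).
Hypotheses (c2 : c + c = 0) (c0 : c != 0).
Hypotheses (Q_odd : odd Q) (cardQ : #|K| = (Q ^ 2)%N).
Hypothesis frobc : forall x, frob c x = x ^+ Q.
Hypothesis two0 : 2%:R != 0 :> K.

Local Notation admissible := (admissible frob c Q).
Local Notation mul := (gk_mul frob c).
Local Notation theta := (theta frob c).

Lemma admissible_kk k B a : admissible k B a -> k + k != 0.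
Proof. by case=> [[l l_odd kl] k0 _ _ _]; apply: (kk_neq0 l_odd kl). Qed.

Lemma thetaV k B a : theta k B^-1 a^-1 = (theta k B a)^-1.
Proof. by rewrite /theta /norm_c !(rmorphM, fmorphV) !invfM !invrK. Qed.

(** The second component of the image of (x, 0) * (u, 0) is symmetric in x and
u, so symmetric_two turns the mixed shape into the equality excluded by
twist_neq. *)
Lemma not_diagonal_antidiagonal k B a k' B' a' (N L M : K * K -> K * K)
    s t al de s' t' al' de' :
  admissible k' B' a' -> al != 0 -> al' != 0 ->
  (forall X Y, N (mul k B a X Y) = mul k' B' a' (L X) (M Y)) ->
  diagonal frob s t al de L -> antidiagonal frob s' t' al' de' M -> False.
Proof.
move=> adm al0 al'0 NLM LE ME.
have fr0 i x : x != 0 -> frob i x != 0 by rewrite frob_eq0.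
have [_ _ a0 _ [B0 _]] := adm.
have hh : k' + c + (k' + c) != 0 by rewrite addrACA c2 addr0 (admissible_kk adm).
have P0 : frob (k' + c) al * al' != 0 by rewrite mulf_neq0 ?fr0.
have Q0 : a' / B' * (al * frob (k' + c) al') != 0 by rewrite !mulf_neq0 ?invr_neq0 ?fr0.
have E x u : (N (mul k B a (x, 0) (u, 0))).2 =
    frob (k' + c) al * al' * (frob (s + (k' + c)) x * frob s' u) +
    a' / B' * (al * frob (k' + c) al') * (frob s x * frob (s' + (k' + c)) u).
  by rewrite NLM LE ME /= !(rmorphM, rmorph0) ![_ + (k' + c)]addrC !frobD; ring.
have [|_ PQ] := symmetric_two frob_faithful P0 Q0 hh (s := s) (s' := s').
  by move=> x u; rewrite -!E (gk_mulC _ _ _ _ _ (x, 0)).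
by have := twist_neq Q_odd cardQ frobc adm (k' + c) al0 al'0; rewrite PQ eqxx.
Qed.

(** Exchanging the two coordinates turns the product of parameters (B, a) into
the one of parameters (1 / B, 1 / a), up to scaling the components.  This
reduces the antidiagonal case to the diagonal one and inverts theta. *)
Theorem isotopism_theta k B a k' B' a' (N L M : K * K -> K * K) :
    admissible k B a -> admissible k' B' a' -> k != - k' ->
    {morph N : X Y / X + Y} -> {morph L : X Y / X + Y} -> {morph M : X Y / X + Y} ->
    bijective L -> bijective M ->
    (forall X Y, N (mul k B a X Y) = mul k' B' a' (L X) (M Y)) ->
  k = k' /\ exists s, theta k' B' a' = frob s (theta k B a) \/
                      theta k' B' a' = (frob s (theta k B a))^-1.
Proof.
move=> adm adm' kNk' ND LD MD Lb Mb NLM.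
have NML X Y : N (mul k B a X Y) = mul k' B' a' (M X) (L Y).
  by rewrite gk_mulC NLM gk_mulC.
have [[l l_odd kl] k0 a0 ac [B0 chiB]] := adm.
have [[l' l'_odd k'l'] k'0 a'0 a'c [B'0 chiB']] := adm'.
have nB' := admissible_norm Q_odd frobc adm'.
have kk := admissible_kk adm; have k'k' := admissible_kk adm'.
have [s [t [al [de [al0 de0 LE]]]]] := isotopism_monomial frobD frob_faithful pK cardK
  c2 c0 l_odd kl k0 l'_odd k'l' k'0 B'0 a'0 a'c nB' ND LD Lb Mb NLM.
have [s' [t' [al' [de' [al'0 de'0 ME]]]]] := isotopism_monomial frobD frob_faithful pK cardK
  c2 c0 l_odd kl k0 l'_odd k'l' k'0 B'0 a'0 a'c nB' ND MD Mb Lb NML.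
case: LE ME => LE [] ME.
- have [-> thE] := diagonal_theta frobD frob_faithful pK cardK c2 kk k'k' kNk' B0 a0 B'0 a'0
    two0 ND NLM al0 de0 al'0 de'0 LE ME.
  by split=> //; exists s; left.
- by case: (not_diagonal_antidiagonal adm' al0 al'0 NLM LE ME).
- by case: (not_diagonal_antidiagonal adm' al'0 al0 NML ME LE).
pose sw (f : K * K -> K * K) X := ((f X).2, (f X).1).
pose N' X := ((N X).1 / B', (N X).2 / (a' / B')).
have N'D : {morph N' : X Y / X + Y}.
  by move=> X Y; congr (_, _); rewrite /= ND mulrDl.
have N'LM X Y : N' (mul k B a X Y) = mul k' B'^-1 a'^-1 (sw L X) (sw M Y).
  by rewrite /N' NLM; congr (_, _); rewrite /= ?invrK; field; rewrite ?B'0 ?a'0.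
have [kE thE] := diagonal_theta frobD frob_faithful pK cardK c2 kk k'k' kNk' B0 a0
    (invr_neq0 B'0) (invr_neq0 a'0) two0 N'D N'LM al0 de0 al'0 de'0
    (s := s) (t := t) (s' := s') (t' := t') (fun X => congr1 (fun z => (z.2, z.1)) (LE X))
    (fun X => congr1 (fun z => (z.2, z.1)) (ME X)).
by split=> //; exists s; right; rewrite -thE thetaV invrK.
Qed.

(** The ratio r of a' and a satisfies frob k r = 1 / r; iterating an odd number
of times gives r = 1 / r. *)
Lemma theta_inj2 k B a a' : admissible k B a -> admissible k B a' ->
  theta k B a = theta k B a' -> a' = a \/ a' = - a.
Proof.
move=> adm [_ _ a'0 _ _]; have [[l l_odd kl] k0 a0 _ [B0 _]] := adm.
rewrite /theta; have n0 : frob k (norm_c frob c B) != 0.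
  by rewrite frob_eq0 // mulf_neq0 ?frob_eq0.
move/(mulIf (invr_neq0 n0)) => e.
pose r := a' / a; have rE : a' = r * a by rewrite /r divfK.
have r0 : r != 0 by rewrite mulf_neq0 ?invr_neq0.
have kr : frob k r = r^-1.
  apply: (mulIf (mulf_neq0 r0 (mulf_neq0 (_ : frob k a != 0) a0))); first by rewrite frob_eq0.
  by rewrite mulKf // [RHS]e rE rmorphM; ring.
have kn n : frob (k *+ n) r = if odd n then r^-1 else r.
  elim: n => [|n IH]; first by rewrite mulr0n (frob0 frobD).
  by rewrite mulrS frobD IH /=; case: odd; rewrite /= ?fmorphV kr ?invrK.
have := kn l; rewrite kl l_odd (frob0 frobD) => rV.
have : r ^+ 2 == 1 by rewrite expr2 {1}rV mulVf.
rewrite sqrf_eq1 rE => /orP[] /eqP ->; [left|right]; by rewrite ?mul1r ?mulN1r.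
Qed.

Lemma theta_fixc k B a : frob c a = a -> frob c (theta k B a) = theta k B a.
Proof.
move=> ac; rewrite /theta /norm_c !(rmorphM, fmorphV) /= -![frob c (frob k _)]frobD addrC.
rewrite !frobD ac -(frobD c c) c2 (frob0 frobD); congr (_ / _); exact: mulrC.
Qed.

End Isotopic.

(** * Powers of Frobenius and counting in finite fields *)

Section FrobeniusPowers.
Variables (p m : nat) (K : finFieldType) (pK : p \in [pchar K]).
Hypotheses (m_gt1 : (1 < m)%N) (cardK : #|K| = (p ^ m)%N).

(** The proof that K has characteristic p is an argument so that the ring
morphism structure can be attached to frobn. *)
Definition frobn (charK : p \in [pchar K]) (i : nat) (x : K) : K := x ^+ (p ^ i).

Lemma frobn_zmod i : zmod_morphism (frobn pK i).
Proof.
move=> x y; rewrite /frobn exprDn_pchar ?exprNn_pchar //;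
by rewrite pnatX (pnatE _ (pcharf_prime pK)) pK.
Qed.

Lemma frobn_monoid i : monoid_morphism (frobn pK i).
Proof. by split=> [|x y]; rewrite /frobn ?expr1n ?exprMn. Qed.

HB.instance Definition _ i :=
  GRing.isZmodMorphism.Build K K (frobn pK i) (frobn_zmod i).
HB.instance Definition _ i :=
  GRing.isMonoidMorphism.Build K K (frobn pK i) (frobn_monoid i).

Definition frobZ (i : 'Z_m) : {rmorphism K -> K} := frobn pK i.

Lemma frobn_mod i (x : K) : x ^+ (p ^ (i %% m)) = x ^+ (p ^ i).
Proof.
rewrite [in RHS](divn_eq i m) expnD exprM; congr (_ ^+ _).
elim: (i %/ m)%N => [|d IH]; first by rewrite mul0n expn0 expr1.
by rewrite mulSn expnD exprM -cardK expf_card.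
Qed.

Lemma frobZD i j x : frobZ (i + j) x = frobZ i (frobZ j x).
Proof.
have ijE : nat_of_ord (i + j) = ((nat_of_ord i + nat_of_ord j) %% m)%N.
  transitivity ((i + j) %% (Zp_trunc m).+2)%N => //.
  by congr (_ %% _)%N; apply: Zp_cast.
rewrite /= /frobn -exprM -expnD [in RHS]addnC -[RHS]frobn_mod.
by congr (_ ^+ (p ^ _)).
Qed.

Lemma frobZ_nat i (x : K) : frobZ i%:R x = x ^+ (p ^ i).
Proof. by rewrite /= /frobn val_Zp_nat // frobn_mod. Qed.

Lemma card_Zm : #|'Z_m| = m.
Proof. by rewrite card_ord Zp_cast. Qed.

(** Otherwise X ^ (p ^ i) - X ^ (p ^ j) would have p ^ m roots, more than its
degree. *)
Lemma frobZ_faithful (i j : 'Z_m) : i != j -> exists x, frobZ i x != frobZ j x.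
Proof.
move=> ij; apply/existsP; apply: contraT => /existsPn /= eq_frob.
have p_gt1 := prime_gt1 (pcharf_prime pK).
pose P : {poly K} := 'X^(p ^ i) - 'X^(p ^ j).
have P0 : P != 0.
  apply/eqP => /(congr1 (fun P : {poly K} => P`_(p ^ i))) /eqP.
  rewrite coefB !coefXn coef0 eqxx eqn_exp2l // (inj_eq val_inj) (negPf ij).
  by rewrite subr0 oner_eq0.
have rP : all (root P) (enum K).
  by apply/allP => x _; rewrite rootE !hornerE subr_eq0; apply/negPn/eq_frob.
have := max_poly_roots P0 rP (enum_uniq K).
rewrite -cardE cardK ltnNge => /negP[].
rewrite (leq_trans (size_polyD _ _)) // size_polyN !size_polyXn geq_max.
have lt_exp (k : 'Z_m) : (p ^ k < p ^ m)%N.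
  by rewrite ltn_exp2l // (leq_trans (ltn_ord k)) // Zp_cast.
by rewrite !lt_exp.
Qed.

End FrobeniusPowers.

Lemma nonsquare_exists (K : finFieldType) (Q : nat) : odd Q -> #|K| = (Q ^ 2)%N ->
  exists B : K, B != 0 /\ chi Q B != 1.
Proof.
move=> Q_odd cardQ; set N := (Q./2 * Q.+1)%N.
have K_gt1 := finNzRing_gt1 K.
have KE : (#|K|.-1 = N.*2)%N.
  have := odd_double_half Q; rewrite cardQ /N Q_odd; move: (Q./2) => q <-.
  by rewrite expnS expn1 -muln2; clear; lia.
have N0 : (0 < N)%N by rewrite -double_gt0 -KE -subn1 subn_gt0.
apply: contrapT => noB.
have rP : all (root ('X^N - 1 : {poly K})) (enum (predC1 (0 : K))).
  apply/allP => x; rewrite mem_enum => x0; rewrite rootE !hornerE subr_eq0.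
  by apply/negPn/negP => x1; apply: noB; exists x.
have := max_poly_roots _ rP (enum_uniq _).
rewrite -size_poly_gt0 size_XnsubC // -cardE cardC1 KE => /(_ isT).
by rewrite ltnS leqNgt -addnn -[X in (X < _)%N]addn0 ltn_add2l N0.
Qed.

Lemma leq_card_fibers (T T' : finType) (A : {set T}) (f : T -> T') (d : nat) :
    (forall x, x \in A -> #|[set y in A | f y == f x]| <= d)%N ->
  (#|A| <= d * #|f @: A|)%N.
Proof.
move=> fib; rewrite -sum1_card (partition_big_imset f) /= mulnC -sum_nat_const.
apply: leq_sum => _ /imsetP[x xA ->]; rewrite (leq_trans _ (fib x xA)) //.
by rewrite -sum1_card; apply: eq_leq; apply: eq_bigl => y; rewrite inE.
Qed.

(** The power map x |-> x ^ (Q + 1) sends the Q ^ 2 - 1 nonzero elements into the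
set, with fibres of at most Q + 1 elements. *)
Lemma card_fixed (K : finFieldType) (Q : nat) : (0 < Q)%N -> #|K| = (Q ^ 2)%N ->
  (Q.-1 <= #|[set a : K | (a != 0%R) && (a ^+ Q == a)%R]|)%N.
Proof.
move=> Q0 cardQ; set S := [set a | _].
have sub : (fun x : K => x ^+ Q.+1) @: [set~ 0] \subset S.
  apply/subsetP => _ /imsetP[x xA ->]; move: xA; rewrite !inE => x0; rewrite expf_neq0 //=.
  by rewrite -exprM mulSn exprD mulnn -cardQ expf_card -exprSr.
rewrite -(leq_pmul2r (ltn0Sn Q)) [leqRHS]mulnC
  (leq_trans _ (leq_mul (leqnn _) (subset_leq_card sub))) //.
have := @leq_card_fibers _ _ [set~ 0] (fun x : K => x ^+ Q.+1) Q.+1.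
rewrite cardsC1 cardQ => h; rewrite (leq_trans _ (h _)) //; first by case: (Q) Q0 => // q _; lia.
move=> x x0.
have rP : all (root ('X^(Q.+1) - (x ^+ Q.+1)%:P : {poly K}))
    (enum [set y in [set~ 0] | y ^+ Q.+1 == x ^+ Q.+1]).
  by apply/allP => y; rewrite mem_enum !inE => /andP[_ /eqP e]; rewrite rootE !hornerE e subrr.
have := max_poly_roots _ rP (enum_uniq _).
by rewrite -size_poly_gt0 size_XnsubC // -cardE => /(_ isT).
Qed.

(** * From products to semifields *)

Lemma cancelD (U V : zmodType) (f : U -> V) (g : V -> U) :
  {morph f : x y / x + y} -> cancel f g -> cancel g f -> {morph g : x y / x + y}.
Proof. by move=> fD fK gK x y; rewrite -{1}(gK x) -{1}(gK y) -fD fK. Qed.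

Section Coordinates.
Import VectorInternalTheory.

Lemma pair_coordinates (p m : nat) (K : finFieldType) : p \in [pchar K] ->
    #|K| = (p ^ m)%N ->
  exists2 f : K * K -> 'rV['F_p]_(m + m), bijective f & {morph f : X Y / X + Y}.
Proof.
move=> pK cardK; pose V : vectType 'F_p := pPrimeCharType pK.
have dimV : dim (V * V)%type = (m + m)%N.
  have dimK : dim V = m.
    rewrite -dimvf (pprimeChar_dimf pK) [#|_|]cardK pfactorK //.
    exact: pcharf_prime pK.
  by rewrite -[LHS]/(dim V + dim V)%N dimK.
move: dimV; move: (m + m)%N => n <-.
pose f := @v2r _ (V * V)%type.
exists f; last by move=> X Y; rewrite -linearD.
exists (@r2v _ (V * V)%type).
  exact: v2rK.
exact: r2vK.
Qed.

End Coordinates.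

(** Kaplansky's trick: with R the multiplication by e, the product
R^-1 x * R^-1 y has the identity element e * e. *)
Lemma kaplansky (p n : nat) (V : zmodType) (f : V -> 'rV['F_p]_n) (op : V -> V -> V) (e : V) :
    bijective f -> {morph f : X Y / X + Y} -> left_distributive op +%R ->
    commutative op -> (forall X Y, op X Y = 0 -> X = 0 \/ Y = 0) -> e != 0 ->
  exists2 mu : binop p n, mu \in comm_semifields p n &
  exists h : 'rV['F_p]_n -> V, [/\ bijective h, {morph h : x y / x + y}
    & forall x y, mu x y = f (op (h x) (h y))].
Proof.
move=> [g fK gK] fD opDl opC op0 e0.
have gD := cancelD fD fK gK.
have opDr : right_distributive op +%R by move=> x y z; rewrite opC opDl !(opC _ x).
have ReD : {morph op^~ e : x y / x + y} by move=> x y; rewrite /= opDl.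
have op0l y : op 0 y = 0 by apply: (addIr (op 0 y)); rewrite -opDl !add0r.
have opNl x y : op (- x) y = - op x y.
  by apply: (addIr (op x y)); rewrite -opDl !addNr op0l.
have Re_inj : injective (op^~ e).
  move=> x y /= /eqP; rewrite -subr_eq0 -opNl -opDl => /eqP /op0[/subr0_eq//|].
  by move/eqP; rewrite (negPf e0).
(* V is finite, being in bijection with the row vectors *)
have [S [SK KS]] : exists S, cancel (op^~ e) S /\ cancel S (op^~ e).
  have [|S SK KS] := @injF_bij _ (fun x => f (op (g x) e)).
    by move=> x y /(can_inj fK)/Re_inj/(can_inj gK).
  exists (fun X => g (S (f X))); split=> X; last first.
    by rewrite -[LHS]fK KS fK.
  by rewrite -[in op X e](fK X) SK fK.
have SD := cancelD ReD SK KS.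
pose h x := S (g x).
have hD : {morph h : x y / x + y} by move=> x y; rewrite /h gD SD.
have f0 : f 0 = 0 by apply: (addIr (f 0)); rewrite -fD !add0r.
have g0 : g 0 = 0 by rewrite -f0 fK.
pose mu : binop p n := [ffun x => [ffun y => f (op (h x) (h y))]].
have muE x y : mu x y = f (op (h x) (h y)) by rewrite !ffunE.
have hf X : h (f (op X e)) = X by rewrite /h fK SK.
have fh x : f (op (h x) e) = x by rewrite /h KS gK.
have h_eq0 x : h x = 0 -> x = 0 by move=> hx; rewrite -[x]fh hx op0l f0.
exists mu; last first.
  by exists h; split=> //; exists (fun X => f (op X e)).
rewrite inE; apply/asboolP; split; last by move=> x y; rewrite !muE opC.
split.
- by move=> x y z; rewrite !muE hD opDl fD.
- by move=> x y z; rewrite !muE hD opDr fD.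
- move=> x y; rewrite muE => /(congr1 g); rewrite fK g0 => /op0[] /h_eq0 ->; by [left|right].
exists (f (op e e)); split=> x; rewrite muE hf; first by rewrite opC fh.
by rewrite fh.
Qed.

Lemma isotopic_conjugate (p n : nat) (V : zmodType) (f : V -> 'rV['F_p]_n)
    (op op' : V -> V -> V) (mu mu' : binop p n) (h h' : 'rV['F_p]_n -> V) :
    bijective f -> {morph f : X Y / X + Y} ->
    bijective h -> {morph h : x y / x + y}
    -> (forall x y, mu x y = f (op (h x) (h y))) ->
    bijective h' -> {morph h' : x y / x + y}
    -> (forall x y, mu' x y = f (op' (h' x) (h' y))) ->
    isotopicb mu mu' ->
  exists N L M : V -> V, [/\ {morph N : X Y / X + Y}, {morph L : X Y / X + Y}
    & {morph M : X Y / X + Y}] /\ [/\ bijective L, bijective M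
    & forall X Y, N (op X Y) = op' (L X) (M Y)].
Proof.
move=> fb fD hb hD muE h'b h'D mu'E /asboolP[N [L [M [_ Lb Mb NLM]]]].
have [g fK gK] := fb; have [i hK iK] := hb.
have gD := cancelD fD fK gK; have iD := cancelD hD hK iK.
have ib : bijective i by exists h.
exists (g \o N \o f), (h' \o L \o i), (h' \o M \o i); split; split.
- by move=> X Y /=; rewrite fD linearD gD.
- by move=> X Y /=; rewrite iD linearD h'D.
- by move=> X Y /=; rewrite iD linearD h'D.
- exact: (bij_comp (bij_comp h'b Lb) ib).
- exact: (bij_comp (bij_comp h'b Mb) ib).
by move=> X Y /=; have := NLM (i X) (i Y); rewrite muE mu'E !iK => ->; rewrite fK.
Qed.

Lemma pblock_isotopic (p n : nat) (mu mu' : binop p n) :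
    mu \in comm_semifields p n -> mu' \in comm_semifields p n ->
    let P := equivalence_partition (@isotopicb p n) (comm_semifields p n) in
  pblock P mu \in P /\ (pblock P mu' = pblock P mu -> isotopicb mu mu').
Proof.
move=> muS mu'S P.
have eqR : {in comm_semifields p n & &, equivalence_rel (@isotopicb p n)}.
  by move=> x y z _ _ _; apply: isotopicb_equiv.
have /and3P[/eqP covP _ _] := equivalence_partitionP eqR.
split; first by rewrite pblock_mem // covP.
move=> e; rewrite -(pblock_equivalence_partition eqR) // -/P -e mem_pblock.
by rewrite covP.
Qed.

(** * Counting isotopy classes *)

Lemma Zm_natr_neq0 (m x : nat) : (1 < m)%N -> (0 < x < m)%N -> x%:R != 0 :> 'Z_m.
Proof.
move=> m1 /andP[x0 xm]; rewrite -(inj_eq val_inj) /= val_Zp_nat // modn_small //.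
by rewrite -lt0n.
Qed.

Lemma Zm_natrm (m : nat) : (1 < m)%N -> m%:R = 0 :> 'Z_m.
Proof. by move=> m1; apply: val_inj; rewrite /= val_Zp_nat // modnn. Qed.

(** The indices k are the multiples w * j.+1 in Z/m with j < s; their sums stay
between 0 and m, so no two of them are opposite.  A fibre of the map from pairs
(k, a) to isotopy classes lies over a single k, and theta takes at most d
conjugates and d inverses of conjugates on it, each of them at most twice. *)
Lemma count_semifields (p d w s : nat) (m := (d + d)%N) :
    prime p -> odd p -> (0 < d)%N -> m = (w * s.*2.+1)%N ->
  (s * (p ^ d).-1 <= (m + m) * num_comm_semifields p (m + m))%N.
Proof.
move=> p_pr p_odd d0 mE.
have m_gt1 : (1 < m)%N by rewrite /m; clear - d0; lia.
have m0 : (0 < m)%N := ltnW m_gt1.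
have [K pK cardK] := PrimePowerField p_pr m0.
have two0 : 2%:R != 0 :> K.
  rewrite -(dvdn_pcharf pK); apply: contraL p_odd => /prime_nt_dvdP -> //.
  by rewrite neq_ltn prime_gt1 ?orbT.
pose Q := (p ^ d)%N.
have Q_odd : odd Q by rewrite oddX p_odd orbT.
have cardQ : #|K| = (Q ^ 2)%N by rewrite cardK /Q -expnM muln2 -addnn.
have Q0 : (0 < Q)%N by rewrite expn_gt0 prime_gt0.
pose frob := frobZ pK (m := m).
have frobD : forall i j x, frob (i + j) x = frob i (frob j x) := frobZD pK m_gt1 cardK.
have faithful := frobZ_faithful pK m_gt1 cardK; rewrite -/frob in faithful.
have cardKG : #|K| = (p ^ #|'Z_m|)%N by rewrite card_Zm.
pose c : 'Z_m := d%:R.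
have c2 : c + c = 0 by rewrite /c -natrD Zm_natrm.
have c0 : c != 0 by rewrite Zm_natr_neq0 // d0 /m -[X in (X < _)%N]addn0 ltn_add2l.
have frobc x : frob c x = x ^+ Q by rewrite /frob frobZ_nat.
have [B [B0 chiB]] := nonsquare_exists Q_odd cardQ.
pose k (j : 'I_s) : 'Z_m := (w * j.+1)%:R.
have w0 : (0 < w)%N by case: (w) mE m0 => // ->.
have lt_m x : (x < s.*2.+1)%N -> (w * x < m)%N by rewrite mE ltn_pmul2l.
have k0 j : k j != 0.
  rewrite Zm_natr_neq0 // muln_gt0 w0 lt_m // ltnS -addnn.
  by rewrite (leq_trans (ltn_ord j)) // leq_addr.
have kNk i j : k i != - k j.
  rewrite -addr_eq0 /k -natrD -mulnDr Zm_natr_neq0 // muln_gt0 w0 lt_m // ltnS -addnn.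
  by rewrite leq_add.
have k_inj : injective k.
  have kE j : val (k j) = (w * j.+1)%N.
    rewrite /k /= val_Zp_nat // modn_small // lt_m // ltnS -addnn.
    by rewrite (leq_trans (ltn_ord j)) // leq_addr.
  move=> i j /(congr1 val); rewrite !kE => /eqP.
  by rewrite eqn_pmul2l // eqSS => /eqP /val_inj.
pose S := [set a : K | (a != 0) && (a ^+ Q == a)].
have adm j a : a \in S -> admissible frob c Q (k j) B a.
  rewrite inE => /andP[a0 /eqP aQ]; split=> //; last by rewrite frobc.
  exists s.*2.+1; first by rewrite /= odd_double.
  by rewrite /k -mulrnA mulnAC -mE mulrnA Zm_natrm // mul0rn.
have [f fb fD] := pair_coordinates pK cardK.
have e0 : (1, 0) != 0 :> K * K by rewrite xpair_eqE oner_eq0.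
have /choice[mu muP] : forall t : 'I_s * K, exists mu : binop p (m + m), t.2 \in S ->
    mu \in comm_semifields p (m + m) /\
    exists h : 'rV['F_p]_(m + m) -> K * K, [/\ bijective h, {morph h : x y / x + y}
    & forall x y, mu x y = f (gk_mul frob c (k t.1) B t.2 (h x) (h y))].
  move=> t.
  have [tS|tS] := boolP (t.2 \in S); last by exists [ffun=> [ffun=> 0]].
  have [mu muS hP] := @kaplansky p (m + m) (K * K)%type f _ _ fb fD (gk_mulDl frob c (k t.1) B t.2)
    (gk_mulC frob c (k t.1) B t.2) (gk_mul_eq0 frobD c2 Q_odd cardQ frobc (adm t.1 t.2 tS) two0) e0.
  by exists mu.
pose th j a := theta frob c (k j) B a.
have iso t t' : t.2 \in S -> t'.2 \in S -> isotopicb (mu t) (mu t') ->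
    t.1 = t'.1 /\ exists i, th t'.1 t'.2 = frob i (th t.1 t.2) \/
                           th t'.1 t'.2 = (frob i (th t.1 t.2))^-1.
  move=> tS t'S; have [_ [h [hb hD muE]]] := muP t tS; have [_ [h' [h'b h'D mu'E]]] := muP t' t'S.
  case/(@isotopic_conjugate _ _ (K * K)%type _ _ _ _ _ _ _ fb fD hb hD muE h'b h'D mu'E)
    => N [L [M [[ND LD MD] [Lb Mb NLM]]]].
  have [/k_inj e thE] := isotopism_theta frobD faithful pK cardKG c2 c0 Q_odd cardQ frobc
    two0 (adm _ _ tS) (adm _ _ t'S) (kNk _ _) ND LD MD Lb Mb NLM.
  by split.
pose P := equivalence_partition (@isotopicb p (m + m)) (comm_semifields p (m + m)).
pose A := setX [set: 'I_s] S.
have AE t : (t \in A) = (t.2 \in S) by rewrite !inE.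
have sub : (fun t => pblock P (mu t)) @: A \subset P.
  apply/subsetP => _ /imsetP[t tA ->]; move: tA; rewrite AE => tS.
  by have [muS _] := muP t tS; have [] := pblock_isotopic muS muS.
rewrite (leq_trans _ (leq_mul (leqnn _) (subset_leq_card sub))) //.
apply: leq_trans (leq_card_fibers (d := (m + m)%N) _); last first.
  move=> t; rewrite AE => tS.
  pose Th := (fun i : 'I_d => frob i%:R (th t.1 t.2)) @: [set: 'I_d].
  pose T := [set a in S | th t.1 a \in Th :|: [set x^-1 | x in Th]].
  have thc : frob c (th t.1 t.2) = th t.1 t.2.
    apply: theta_fixc => //; move: tS; rewrite inE => /andP[_ /eqP].
    by rewrite frobc.
  have ThE i : frob i (th t.1 t.2) \in Th.
    apply/imsetP; exists (Ordinal (ltn_pmod i d0)); first by rewrite inE.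
    have cq q : frob (q * d)%:R (th t.1 t.2) = th t.1 t.2.
      elim: q => [|q IH]; first by rewrite mul0n (frob0 frobD).
      by rewrite mulSn natrD frobD IH.
    have iE : i = (i %% d)%:R + (i %/ d * d)%:R.
      by rewrite -natrD addnC -divn_eq natr_Zp.
    by rewrite {1}iE frobD cq.
  have subT : [set u in A | pblock P (mu u) == pblock P (mu t)] \subset setX [set t.1] T.
    apply/subsetP => u; rewrite inE AE => /andP[uS /eqP e].
    have [muS _] := muP t tS; have [muS' _] := muP u uS.
    have [_ /(_ e) tu] := pblock_isotopic muS muS'.
    have [ut [i thE]] := iso t u tS uS tu.
    have thTh : th u.1 u.2 \in Th :|: [set x^-1 | x in Th].
      by case: thE => ->; rewrite in_setU ?ThE // imset_f ?orbT.
    rewrite [u \in _]inE in_set1 -ut eqxx [u.2 \in T]inE uS ut.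
    exact: thTh.
  apply: leq_trans (subset_leq_card subT) _; rewrite cardsX cards1 mul1n.
  have cT : (#|T| <= 2 * #|th t.1 @: T|)%N.
    apply: leq_card_fibers => a; rewrite inE => /andP[aS _].
    apply: leq_trans (_ : #|[set a; - a]| <= 2)%N; last by rewrite cards2; case: eqP.
    apply/subset_leq_card/subsetP => b; rewrite !inE => /andP[/andP[bS _] /eqP e].
    have bS' : b \in S by rewrite inE.
    by have [->|->] := theta_inj2 frobD (adm _ _ aS) (adm _ _ bS') (esym e); rewrite eqxx ?orbT.
  apply: leq_trans cT _; rewrite addnn -mul2n leq_mul2l /=.
  have subTh : th t.1 @: T \subset Th :|: [set x^-1 | x in Th].
    by apply/subsetP => _ /imsetP[a aT ->]; move: aT; rewrite inE => /andP[_ h].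
  apply: leq_trans (subset_leq_card subTh) _.
  apply: leq_trans (leq_card_setU _ _) _.
  have cTh : (#|Th| <= d)%N by rewrite (leq_trans (leq_imset_card _ _)) // cardsT card_ord.
  by rewrite leq_add // (leq_trans (leq_imset_card _ _)).
by rewrite cardsX cardsT card_ord leq_mul2l card_fixed ?orbT.
Qed.

Theorem mainTheorem1 (p n : nat) (p_prime : prime p) (p_odd : odd p)
    (n_gt0 : (0 < n)%N) (n_val : (2 <= logn 2 n)%N) :
  ((odd_part n)%:R - 1) * (p%:R ^+ (n %/ 4) - 1) / (2 * n%:R)
    <= (num_comm_semifields p n)%:R :> rat.
Proof.
have [t] := pfactor_coprime (isT : prime 2) n_gt0; rewrite coprime2n => t_odd nE.
have [v vE] : exists v, logn 2 n = v.+2 by exists (logn 2 n).-2; case: logn n_val => [|[]].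
rewrite vE in nE; have pE : (2 ^ v.+2 = 4 * 2 ^ v)%N by rewrite !expnS mulnA.
have tE : odd_part n = t by rewrite /odd_part vE nE mulnK // expn_gt0.
pose d := (t * 2 ^ v)%N.
have dE : (n %/ 4)%N = d by rewrite nE pE mulnCA mulKn.
have sE : (t = t./2.*2.+1)%N by rewrite -[LHS]odd_double_half t_odd.
have d_gt0 : (0 < d)%N by rewrite muln_gt0 expn_gt0 sE.
have mE : (d + d = 2 ^ v.+1 * t./2.*2.+1)%N
  by rewrite -sE addnn -mul2n expnS mulnCA mulnC -mulnA [(_ * t)%N]mulnC.
have n4 : (d + d + (d + d) = n)%N by rewrite nE pE /d; lia.
have := count_semifields p_prime p_odd d_gt0 mE; rewrite n4 tE dE.
have -> : t%:R = (t./2)%:R * 2 + 1 :> rat.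
  by rewrite -natrM natr1 muln2 -sE.
have q0 : (0 < p ^ d)%N by rewrite expn_gt0 prime_gt0.
rewrite -(ler_nat rat) !natrM -subn1 natrB // natrX => le.
rewrite ler_pdivrMr ?mulr_gt0 ?ltr0n //; nra.
Qed.
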